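(* Let $\Gamma$ be a group generated by a finite symmetric set $S$, acting by permutations on a countably infinite set $X$, and let $S_\Gamma$ be the Schreier graph of this action with respect to $S$. The following are equivalent: (1) The action is hyperfinite, i.e. there is a regular Borel probability measure $\nu$ on $\beta X$, invariant under the extended action, such that the extended action is hyperfinite with respect to $\nu$; (2) $S_\Gamma$ contains a hyperfinite Følner sequence; (3) there exists a $\Gamma$-invariant mean $\mu$ on $X$ such that for every $\varepsilon>0$ there exist $Y\subseteq X$ with $\mu(Y)<\varepsilon$ and $K>0$ such that every connected component of the subgraph of $S_\Gamma$ induced on $X\setminus Y$ has at most $K$ vertices.
   Context: A mean on $X$ is a finitely additive map $\mu:2^X\to[0,1]$ with $\mu(X)=1$; it is $\Gamma$-invariant if $\mu(\gamma A)=\mu(A)$ for all $\gamma\in\Gamma$, $A\subseteq X$. $\beta X$ is the Stone–Čech compactification, i.e. the space of ultrafilters on $X$ with basic clopen sets $U_A=\{\omega: A\in\omega\}$; each bijection $s$ of $X$ extends to the homeomorphism $\tilde s(\omega)=\{s(A):A\in\omega\}$, which gives the extended action of $\Gamma$ on $\beta X$. The Schreier graph $S_\Gamma$ has vertex set $X$ and an edge $\{x,y\}$ whenever $x\ne y$ and $s(x)=y$ for some $s\in S$ (no loops). The graphing $\mathcal G$ of the extended action is the graph on $\beta X$ with an edge $\{\omega,\omega'\}$ whenever $\omega\neq\omega'$ and $\tilde s(\omega)=\omega'$ for some $s\in S$. For a Borel probability $\nu$ on $\beta X$ and a Borel set of edges $W\subseteq E(\mathcal G)$, the edge measure is $\nu_E(W)=\frac12\int\deg_W\,d\nu$.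 The extended action is hyperfinite with respect to an invariant $\nu$ if for every $\varepsilon>0$ there exist $K$ and a Borel $W\subseteq E(\mathcal G)$ with $\nu_E(E(\mathcal G)\setminus W)<\varepsilon$ such that every connected component of $(\beta X,W)$ has at most $K$ vertices. A Følner sequence in a graph $G$ is a sequence of finite vertex sets (induced subgraphs) $F_n$ with $i(F_n)\to0$, where $i(F)$ is the number of edges between $F$ and its complement divided by $|F|$. A sequence of finite graphs $(G_n)$ of bounded degree is hyperfinite if for every $\varepsilon>0$ there are $K>0$ and $Y_n\subseteq V(G_n)$ with $|Y_n|<\varepsilon|V(G_n)|$ such that every component of the subgraph induced on $V(G_n)\setminus Y_n$ has at most $K$ vertices, for all $n$. *)

(* Defs.v *)
From HB Require Import structures.
From mathcomp Require Import all_boot all_order all_algebra.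
From mathcomp Require Import all_classical all_reals all_analysis.
From Stdlib Require Import Relations.Relation_Operators.
From Stdlib Require List.

Set Implicit Arguments.
Unset Strict Implicit.
Unset Printing Implicit Defensive.

Import Order.TTheory GRing.Theory Num.Theory numFieldNormedType.Exports.
Local Open Scope classical_set_scope.

(* number of elements of a set (0 if the set is infinite) *)
Definition ncard (T : Type) (A : set T) : nat :=
  xget 0%N [set n : nat | exists l : list T,
     List.NoDup l /\ List.length l = n /\ (forall y, List.In y l <-> A y)].

Definition card_le (T : Type) (A : set T) (K : nat) : Prop :=
  exists l : list T, (List.length l <= K)%N /\ A `<=` [set y | List.In y l].

Definition is_action (G : groupType) (X : Type) (act : G -> X -> X) : Prop :=
  (forall x, act (@monoid.one G) x = x) /\
  (forall g h x, act (monoid.mul g h) x = act g (act h x)).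

Definition symmetric_gen_set (G : groupType) (S : seq G) : Prop :=
  (forall s, s \in S -> monoid.inv s \in S) /\
  (forall g : G, exists w : seq G, all (fun s => s \in S) w /\
       g = foldr (@monoid.mul G) (@monoid.one G) w).

Definition schreier_adj (G : groupType) (X : Type) (S : seq G)
  (act : G -> X -> X) (x y : X) : Prop :=
  x <> y /\ exists2 s, s \in S & act s x = y.

Definition induced_conn (G : groupType) (X : Type) (S : seq G)
  (act : G -> X -> X) (V : set X) : X -> X -> Prop :=
  clos_refl_trans X (fun a b => V a /\ V b /\ schreier_adj S act a b).

Definition components_le (G : groupType) (X : Type) (S : seq G)
  (act : G -> X -> X) (V : set X) (K : nat) : Prop :=
  forall x, V x -> card_le [set y | induced_conn S act V x y] K.

Definition isoperimetric (R : realType) (G : groupType) (X : Type)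
  (S : seq G) (act : G -> X -> X) (F : set X) : R :=
  ((ncard [set p : X * X | F p.1 /\ ~ F p.2 /\ schreier_adj S act p.1 p.2])%:R
    / (ncard F)%:R)%R.

Definition folner_seq (R : realType) (G : groupType) (X : Type)
  (S : seq G) (act : G -> X -> X) (F : nat -> set X) : Prop :=
  (forall n, finite_set (F n) /\ F n !=set0) /\
  ((fun n => isoperimetric R S act (F n)) @ \oo --> (0%R : R)).

Definition hyperfinite_seq (R : realType) (G : groupType) (X : Type)
  (S : seq G) (act : G -> X -> X) (F : nat -> set X) : Prop :=
  forall eps : R, (0 < eps)%R ->
    exists K : nat, (0 < K)%N /\
    exists Y : nat -> set X, forall n,
      Y n `<=` F n /\
      ((ncard (Y n))%:R < eps * (ncard (F n))%:R)%R /\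
      components_le S act (F n `\` Y n) K.

Definition is_mean (R : realType) (X : Type) (mu : set X -> R) : Prop :=
  (forall A, (0 <= mu A <= 1)%R) /\ mu setT = 1%R /\
  (forall A B, A `&` B = set0 -> mu (A `|` B) = (mu A + mu B)%R).

Definition invariant_mean (R : realType) (G : groupType) (X : Type)
  (act : G -> X -> X) (mu : set X -> R) : Prop :=
  forall (g : G) (A : set X), mu (act g @` A) = mu A.

Definition is_ultrafilter (X : Type) (F : set (set X)) : Prop :=
  [/\ F setT, ~ F set0,
      (forall A B, F A -> F B -> F (A `&` B)),
      (forall A B, A `<=` B -> F A -> F B) &
      (forall A, F A \/ F (~` A))].

Record betaX (X : Type) := MkBeta {
  ufsets : set (set X);
  ufP : is_ultrafilter ufsets }.

Lemma principal_ultrafilter (X : Type) (x0 : X) :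
  is_ultrafilter [set A : set X | A x0].
Proof.
split.
- by [].
- by [].
- by move=> A B /= HA HB; split.
- by move=> A B AB /= /AB.
- by move=> A /=; have [h|h] := pselect (A x0); [left|right].
Qed.

HB.instance Definition _ (X : Type) := gen_eqMixin (betaX X).
HB.instance Definition _ (X : Type) := gen_choiceMixin (betaX X).
HB.instance Definition _ (X : pointedType) :=
  isPointed.Build (betaX X) (MkBeta (principal_ultrafilter (@point X))).

Definition U_ (X : Type) (A : set X) : set (betaX X) :=
  [set w | ufsets w A].

Definition image_filter (X : Type) (f : X -> X) (w : betaX X) : set (set X) :=
  [set B | exists2 A, ufsets w A & B = f @` A].

(* extension of a map to beta X: w |-> {f(A) : A in w}.  This is an
   ultrafilter whenever f is a bijection (the only case used); the
   fallback branch is never reached for bijections. *)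
Definition ext (X : Type) (f : X -> X) (w : betaX X) : betaX X :=
  match pselect (is_ultrafilter (image_filter f w)) with
  | left h => MkBeta h
  | right _ => w
  end.

Definition openB (X : Type) (O : set (betaX X)) : Prop :=
  forall w, O w -> exists A, U_ A w /\ U_ A `<=` O.

Definition compactB (X : Type) (K : set (betaX X)) : Prop :=
  forall (I : Type) (O : I -> set (betaX X)),
    (forall i, openB (O i)) -> K `<=` \bigcup_i O i ->
    exists l : list I, K `<=` \bigcup_(i in [set i | List.In i l]) O i.

Definition openB2 (X : Type) (O : set (betaX X * betaX X)) : Prop :=
  forall p, O p -> exists A B, U_ A p.1 /\ U_ B p.2 /\
     [set q | U_ A q.1 /\ U_ B q.2] `<=` O.

Definition BorelB2 (X : Type) (W : set (betaX X * betaX X)) : Prop :=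
  <<s [set O | openB2 O] >> W.

Definition betaXm (X : pointedType) :=
  g_sigma_algebraType [set O : set (betaX X) | openB O].

Definition regular_measure (R : realType) (X : pointedType)
  (nu : set (betaXm X) -> \bar R) : Prop :=
  forall B : set (betaXm X), measurable B ->
    nu B = ereal_inf [set nu U | U in [set U | openB U /\ B `<=` U]] /\
    nu B = ereal_sup [set nu K | K in [set K | compactB K /\ K `<=` B]].

Definition ext_invariant (R : realType) (G : groupType) (X : pointedType)
  (act : G -> X -> X) (nu : set (betaXm X) -> \bar R) : Prop :=
  forall (g : G) (B : set (betaXm X)), measurable B ->
    nu (ext (act g) @^-1` B) = nu B.

(* edges (as symmetric sets of ordered pairs) of the graphing *)
Definition graphing_edges (G : groupType) (X : Type) (S : seq G)
  (act : G -> X -> X) : set (betaX X * betaX X) :=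
  [set p | p.1 <> p.2 /\ exists2 s, s \in S & ext (act s) p.1 = p.2].

Definition edge_measure (R : realType) (X : pointedType)
  (nu : probability (betaXm X) R) (W : set (betaX X * betaX X)) : \bar R :=
  ((1/2)%:E * \int[nu]_w (ncard [set w' | W (w, w')])%:R%:E)%E.

Definition connW (X : Type) (W : set (betaX X * betaX X)) :=
  clos_refl_trans (betaX X) (fun a b => W (a, b)).

Definition hyperfinite_wrt (R : realType) (G : groupType) (X : pointedType)
  (S : seq G) (act : G -> X -> X) (nu : probability (betaXm X) R) : Prop :=
  forall eps : R, (0 < eps)%R ->
    exists K : nat, exists W : set (betaX X * betaX X),
      [/\ BorelB2 W, W `<=` graphing_edges S act,
          (forall a b, W (a, b) -> W (b, a)),
          (edge_measure nu (graphing_edges S act `\` W) < eps%:E)%E &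
          forall w, card_le [set w' | connW W w w'] K].

(* Main.v *)
From Pilot Require Import Defs.
From HB Require Import structures.
From mathcomp Require Import all_boot all_order all_algebra.
From mathcomp Require Import finmap.
From mathcomp Require Import all_classical all_reals all_analysis.
From mathcomp Require Import measurable_realfun ring lra.
From Stdlib Require Import Relations.Relation_Operators.
From Stdlib Require List.
Import Pilot.Defs.

Set Implicit Arguments.
Unset Strict Implicit.
Unset Printing Implicit Defensive.

Import Order.TTheory GRing.Theory Num.Theory numFieldNormedType.Exports.
Local Open Scope classical_set_scope.

(**
Means mu on X and regular Borel probabilities nu on beta X correspond to each
other through nu (U_ A) = mu A.

(1) -> (3): the bad points, which have a graphing edge outside W, lie in an open
set O of small measure, and the graphing induced on the closed set ~` O has
components of size at most K. Failing this bound is witnessed by one of finitely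
many patterns of K+1 words in the generators, so by compactness some clopen set
U_ A containing ~` O still satisfies it, and then so does A. Transferring
inequalities between words from beta X to X uses that a fixed point w of the
extension of a permutation contains the set of fixed points of the permutation.

(3) -> (1): nu is the Caratheodory measure of the outer measure which is inner
regular on open sets with respect to clopen sets, and W consists of the graphing
edges inside U_ (~` Y).

(3) -> (2): if Y_0 has very small mean, then by mass transport some component C
of ~` Y_0 has both a small boundary and a small intersection with finitely many
prescribed sets Y_j; these components form the Folner sequence, and the sets Y_j
witness its hyperfiniteness.

(2) -> (3): if some F_n has empty boundary, take the uniform mean on it.
Otherwise |F_n| is unbounded, and after passing to a subsequence each F_n is much
larger than the union of its predecessors, so that the sequence can be made
disjoint; mu is an ultralimit of the uniform means.
*)

(** * Cardinality of finite sets *)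

Lemma List_InP (T : eqType) (l : seq T) (x : T) : List.In x l <-> x \in l.
Proof.
elim: l => [|y l IH] //=; rewrite inE; split.
  by case=> [->|/IH ->]; rewrite ?eqxx ?orbT.
by case/orP => [/eqP ->|/IH]; [left|right].
Qed.

Lemma List_NoDupP (T : eqType) (l : seq T) : List.NoDup l <-> uniq l.
Proof.
elim: l => [|y l IH] /=; first by split=> // _; exact: List.NoDup_nil.
split=> [h|/andP[yl /IH ul]].
  inversion h as [|? ? yl ul]; apply/andP; split; last exact/IH.
  by apply/negP => /List_InP.
by apply: List.NoDup_cons => // /List_InP yl'; rewrite yl' in yl.
Qed.

(** Two duplicate-free enumerations of a set are permutations of each other, so the choice made by
    [xget] in [ncard] is forced. *)
Lemma ncard_uniq (T : choiceType) (A : set T) (l : seq T) :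
  uniq l -> (forall y, y \in l <-> A y) -> ncard A = size l.
Proof.
move=> ul lA; rewrite /ncard; apply: xget_subset1.
  by exists l; split; [exact/List_NoDupP|split=> // y; rewrite List_InP lA].
move=> n m [l1 [/List_NoDupP u1 [<- h1]]] [l2 [/List_NoDupP u2 [<- h2]]].
apply/perm_size/uniq_perm => // y.
by apply/idP/idP => /List_InP; [move/h1/h2|move/h2/h1]; move/List_InP.
Qed.

Lemma ncardE (T : choiceType) (A : set T) :
  finite_set A -> ncard A = #|` fset_set A|%fset.
Proof.
move=> fA; apply: ncard_uniq => [|y]; first exact: fset_uniq.
by rewrite in_fset_set// inE.
Qed.

Lemma ncard0 (T : choiceType) : ncard (@set0 T) = 0%N.
Proof. exact: (@ncard_uniq _ _ [::]). Qed.

Lemma ncard_le (T : choiceType) (A B : set T) :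
  finite_set B -> A `<=` B -> (ncard A <= ncard B)%N.
Proof.
move=> fB AB; have fA := sub_finite_set AB fB.
rewrite !ncardE//; apply: fsubset_leq_card.
by rewrite -fset_set_sub.
Qed.

Lemma ncardU_le (T : choiceType) (A B : set T) :
  finite_set A -> finite_set B -> (ncard (A `|` B) <= ncard A + ncard B)%N.
Proof.
move=> fA fB; rewrite !ncardE ?finite_setU// fset_setU//.
by rewrite cardfsU leq_subr.
Qed.

Lemma ncardU (T : choiceType) (A B : set T) :
  finite_set A -> finite_set B -> A `&` B = set0 ->
  ncard (A `|` B) = (ncard A + ncard B)%N.
Proof.
move=> fA fB AB; rewrite !ncardE ?finite_setU// fset_setU//.
by rewrite cardfsU -fset_setI// AB fset_set0 cardfs0 subn0.
Qed.

Lemma ncard_image_le (T U : choiceType) (f : T -> U) (A : set T) :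
  finite_set A -> (ncard (f @` A) <= ncard A)%N.
Proof.
move=> fA; rewrite !ncardE//; last exact: finite_image.
by rewrite fset_set_image// leq_imfset_card.
Qed.

Lemma ncard_gt0 (T : choiceType) (A : set T) :
  finite_set A -> A !=set0 -> (0 < ncard A)%N.
Proof.
move=> fA [x Ax]; rewrite ncardE// cardfs_gt0; apply/fset0Pn; exists x.
by rewrite in_fset_set// inE.
Qed.

Lemma ncard_bigcup_le (T I : choiceType) (l : seq I) (A : I -> set T) :
  (forall i, i \in l -> finite_set (A i)) ->
  (ncard (\bigcup_(i in [set` l]) A i) <= \sum_(i <- l) ncard (A i))%N.
Proof.
elim: l => [|i l IH] fA.
  by rewrite set_nil bigcup_set0 ncard0.
have fl j : j \in l -> finite_set (A j).
  by move=> jl; apply: fA; rewrite inE jl orbT.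
rewrite big_cons [X in ncard X](_ : _ = A i `|` \bigcup_(j in [set` l]) A j).
  apply: leq_trans (leq_add (leqnn _) (IH fl)).
  apply: ncardU_le; first by apply: fA; rewrite mem_head.
  by apply: bigcup_finite => //= j; exact: fl.
by rewrite -bigcup_setU1; congr (bigcup _ _); apply/seteqP; split=> j /=;
  rewrite inE => /predU1P.
Qed.

Lemma card_le_uniq (T : choiceType) (A : set T) (K : nat) :
  card_le A K <-> exists l : seq T, (size l <= K)%N /\ A `<=` [set` l].
Proof.
by split=> -[l [h1 h2]]; exists l; split => // y /h2 /=; move/List_InP.
Qed.

Lemma card_le_finite (T : choiceType) (A : set T) (K : nat) :
  card_le A K -> finite_set A.
Proof.
by move=> /card_le_uniq[l [_ Al]]; apply: sub_finite_set Al _.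
Qed.

Lemma card_le_sub (T : Type) (A B : set T) (K : nat) :
  A `<=` B -> card_le B K -> card_le A K.
Proof. by move=> AB [l [h1 h2]]; exists l; split => // y /AB/h2. Qed.

Lemma card_le_leq (T : Type) (A : set T) (K K' : nat) :
  (K <= K')%N -> card_le A K -> card_le A K'.
Proof. by move=> KK' [l [h1 h2]]; exists l; split => //; exact: leq_trans KK'. Qed.

Lemma card_le_ncard (T : choiceType) (A : set T) :
  finite_set A -> card_le A (ncard A).
Proof.
move=> fA; apply/card_le_uniq; exists (fset_set A).
by rewrite ncardE//; split=> // y Ay; rewrite /= in_fset_set// inE.
Qed.

Lemma card_le_pigeonhole (T : choiceType) (A : set T) (K : nat) (l : seq T) :
  uniq l -> [set` l] `<=` A -> (K < size l)%N -> ~ card_le A K.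
Proof.
move=> ul lA Kl /card_le_uniq[l' [l'K Al']].
have : (size l <= size l')%N.
  by apply: uniq_leq_size => // y yl; apply: Al'; exact: lA.
by move/leq_trans/(_ l'K); rewrite leqNgt Kl.
Qed.

Lemma not_card_le (T : choiceType) (A : set T) (K : nat) :
  ~ card_le A K -> exists l : seq T, [/\ uniq l, size l = K.+1 & [set` l] `<=` A].
Proof.
move=> nA; suff: forall n, (n <= K.+1)%N ->
    exists l : seq T, [/\ uniq l, size l = n & [set` l] `<=` A] by exact.
elim=> [_|n IH nK]; first by exists [::].
have [l [ul sl lA]] := IH (ltnW nK).
have [Al|/existsNP[y /not_implyP[Ay yl]]] := pselect (A `<=` [set` l]).
  exfalso; apply: nA; apply/card_le_uniq; exists l; split => //.
  by rewrite sl -ltnS.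
exists (y :: l); split => /=; last by move=> z; rewrite /= inE => /orP[/eqP ->|/lA].
  by rewrite ul andbT; apply/negP.
by rewrite sl.
Qed.

(** * Words, walks and components *)

(** The empty word is kept at every stage, so these are the words of length at most [k]. *)
Fixpoint words (G : groupType) (S : seq G) (k : nat) : seq (seq G) :=
  if k is k'.+1 then [::] :: [seq s :: w | s <- S, w <- words S k']
  else [:: [::]].

Arguments words : simpl never.

Lemma words_consP (G : groupType) (S : seq G) k s w :
  (s :: w \in words S k.+1) = (s \in S) && (w \in words S k).
Proof.
rewrite inE; apply/allpairsP/andP => [[[s' w'] /= [sS wS [-> ->]]]|[sS wS]] //.
by exists (s, w).
Qed.

Lemma words_nil (G : groupType) (S : seq G) k : [::] \in words S k.
Proof. by case: k => [|k]; rewrite inE. Qed.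

Lemma mem_words (G : groupType) (S : seq G) k w :
  (w \in words S k) = all (mem S) w && (size w <= k)%N.
Proof.
elim: k w => [|k IH] [|s w]; rewrite ?words_nil//.
  by rewrite inE andbF.
by rewrite words_consP IH/= andbA.
Qed.

(** Since [foldr] applies the last letter first, the points visited are those of the suffixes of
    [w], the start [x] included. *)
Fixpoint walk_in (G T : Type) (a : G -> T -> T) (V : set T) (x : T)
    (w : seq G) : Prop :=
  V (foldr a x w) /\ if w is _ :: w' then walk_in a V x w' else True.

Lemma walk_in_sub (G T : Type) (a : G -> T -> T) (V V' : set T) x w :
  V `<=` V' -> walk_in a V x w -> walk_in a V' x w.
Proof. by move=> VV'; elim: w => [|s w IH] /= [/VV' h1] => // /IH. Qed.

Lemma walk_in_end (G T : Type) (a : G -> T -> T) (V : set T) x w :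
  walk_in a V x w -> V (foldr a x w).
Proof. by case: w => [|s w] []. Qed.

Lemma conn_walk (G : groupType) (S : seq G) (T : Type) (a : G -> T -> T)
    (V : set T) (x y : T) : V x -> induced_conn S a V x y ->
  exists w, [/\ all (mem S) w, walk_in a V x w & foldr a x w = y].
Proof.
move=> Vx xy; have {xy} := Operators_Properties.clos_rt_rtn1 _ _ _ _ xy.
elim=> [|z t]; first by exists [::].
move=> [Vz [Vt [_ [s sS st]]]] _ [w [wS wV wz]].
by exists (s :: w); split; rewrite /= ?wz ?st ?sS.
Qed.

Lemma walk_conn (G : groupType) (S : seq G) (T : Type) (a : G -> T -> T)
    (V : set T) (x : T) w : all (mem S) w -> walk_in a V x w ->
  induced_conn S a V x (foldr a x w).
Proof.
elim: w => [|s w IH] /=; first by move=> _ _; exact: rt_refl.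
move=> /andP[sS wS] [Vs wV]; have cw := IH wS wV.
(* A letter fixing the current point gives no edge, and the walk stands still. *)
have [<-//|ne] := pselect (foldr a x w = a s (foldr a x w)).
apply: rt_trans cw _; apply: rt_step; split; first exact: walk_in_end.
by split=> //; split=> //; exists s.
Qed.

Lemma induced_conn_in (G : groupType) (S : seq G) (T : Type) (a : G -> T -> T)
    (V : set T) (x y : T) : V x -> induced_conn S a V x y -> V y.
Proof.
by move=> Vx xy; have [w [_ wV <-]] := conn_walk Vx xy; exact: walk_in_end wV.
Qed.

Lemma induced_conn_sub (G : groupType) (S : seq G) (T : Type) (a : G -> T -> T)
    (V V' : set T) : V `<=` V' ->
  forall x y, induced_conn S a V x y -> induced_conn S a V' x y.
Proof.
move=> VV' x y; elim=> [z t [Vz [Vt zt]]|z|z t u _ h1 _ h2].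
- by apply: rt_step; split; [exact: VV'|split=> //; exact: VV'].
- exact: rt_refl.
- exact: rt_trans h1 h2.
Qed.

Lemma components_le_sub (G : groupType) (S : seq G) (T : Type) (a : G -> T -> T)
    (V V' : set T) K : V `<=` V' -> components_le S a V' K ->
  components_le S a V K.
Proof.
move=> VV' h x Vx; apply: card_le_sub (h x (VV' _ Vx)) => y /=.
exact: induced_conn_sub.
Qed.

Lemma components_le_leq (G : groupType) (S : seq G) (T : Type) (a : G -> T -> T)
    (V : set T) K K' : (K <= K')%N -> components_le S a V K ->
  components_le S a V K'.
Proof. by move=> KK' h x /h; exact: card_le_leq. Qed.

Lemma components_le_finite (G : groupType) (S : seq G) (T : choiceType)
    (a : G -> T -> T) (V : set T) :
  finite_set V -> components_le S a V (ncard V).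
Proof.
move=> fV x Vx; apply: card_le_sub (card_le_ncard fV) => y /=.
exact: induced_conn_in.
Qed.

(* A component whose ball of radius [k] is not everything gains at least one
   point with each unit of radius. *)
Lemma ball_growth (G : groupType) (S : seq G) (T : choiceType)
    (a : G -> T -> T) (V : set T) (x : T) k : V x ->
  let ball := [set y | exists2 w, w \in words S k &
                       walk_in a V x w /\ foldr a x w = y] in
  (exists l : seq T, [/\ uniq l, size l = k.+1 & [set` l] `<=` ball]) \/
  [set y | induced_conn S a V x y] `<=` ball.
Proof.
move=> Vx; elim: k => [|k IH] /=.
  left; exists [:: x]; split => // y; rewrite /= inE => /eqP ->.
  by exists [::] => //; exact: words_nil.
have incr y : (exists2 w, w \in words S k & walk_in a V x w /\ foldr a x w = y) ->
    exists2 w, w \in words S k.+1 & walk_in a V x w /\ foldr a x w = y.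
  move=> [w wk ?]; exists w => //; move: wk; rewrite !mem_words => /andP[-> wk].
  by rewrite leqW.
case: IH => [[l [ul sl lb]]|cb]; last by right => y /cb; exact: incr.
(* Either a generator leads from the ball to a new point of [V], or the ball is closed under steps
   and contains the component. *)
have [[z [t [zb [[s sS zt] Vt tb]]]]|ncl] := pselect (exists z t,
    (exists2 w, w \in words S k & walk_in a V x w /\ foldr a x w = z) /\
    [/\ exists2 s, s \in S & a s z = t, V t &
    ~ exists2 w, w \in words S k & walk_in a V x w /\ foldr a x w = t]).
  left; exists (t :: l); split; rewrite /= ?sl// ?ul ?andbT.
    by apply/negP => /lb.
  move=> u; rewrite /= inE => /predU1P[->|/lb/incr//].
  case: zb => w wk [wV wz]; exists (s :: w); first by rewrite words_consP sS.
  by rewrite /= wz zt.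
right => y /= xy; apply: incr.
have {xy} := Operators_Properties.clos_rt_rtn1 _ _ _ _ xy; elim=> [|z t].
  by exists [::]; [exact: words_nil|].
move=> [Vz [Vt [_ st]]] _ zb; apply: contrapT => tb.
by apply: ncl; exists z, t.
Qed.

(** Radius [K] suffices: a ball of that radius missing part of the component would already have
    [K.+1] points of it. *)
Lemma components_le_words (G : groupType) (S : seq G) (T : choiceType)
    (a : G -> T -> T) (V : set T) K x y : components_le S a V K -> V x ->
  induced_conn S a V x y -> exists2 w, w \in words S K & foldr a x w = y.
Proof.
move=> VK Vx xy; have [[l [ul sl lb]]|cb] := @ball_growth _ S _ a V x K Vx.
  exfalso; apply: (card_le_pigeonhole ul _ _ (VK _ Vx)); last by rewrite sl.
  move=> z /lb[w]; rewrite mem_words => /andP[wS _] [wV <-]; exact: walk_conn.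
by have [w wK [_ wy]] := cb _ xy; exists w.
Qed.

(** A pattern chooses [K.+1] words of length at most [K]; encoding words by their indices makes
    patterns a finite type, as the compactness argument requires. *)
Local Notation pattern S K := {ffun 'I_K.+1 -> 'I_(size (words S K))}.

Definition pattern_word (G : groupType) (S : seq G) (K : nat)
  (p : pattern S K) (i : 'I_K.+1) : seq G := nth [::] (words S K) (p i).

Definition realizes (G : groupType) (S : seq G) (T : Type) (a : G -> T -> T)
    (V : set T) (K : nat) (p : pattern S K) (x : T) : Prop :=
  (forall i, walk_in a V x (pattern_word p i)) /\
  (forall i j, i != j ->
    foldr a x (pattern_word p i) <> foldr a x (pattern_word p j)).

Lemma pattern_word_sub (G : groupType) (S : seq G) K (p : pattern S K) i :
  all (mem S) (pattern_word p i).
Proof. have : pattern_word p i \in words S K by rewrite mem_nth.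
by rewrite mem_words => /andP[]. Qed.

(** The [K.+1] points come from the growth of balls or, if the ball of radius [K] fills the
    component, from the component itself. *)
Lemma not_components_le (G : groupType) (S : seq G) (T : choiceType)
    (a : G -> T -> T) (V : set T) (K : nat) : ~ components_le S a V K ->
  exists x, V x /\ exists p : pattern S K, realizes a V p x.
Proof.
move=> /existsNP[x /not_implyP[Vx nc]]; exists x; split => //.
have [l [ul sl lb]] : exists l : seq T, [/\ uniq l, size l = K.+1 & [set` l] `<=`
    [set y | exists2 w, w \in words S K & walk_in a V x w /\ foldr a x w = y]].
  have [//|cb] := @ball_growth _ S _ a V x K Vx.
  have [l [ul sl lc]] := not_card_le nc.
  by exists l; split => // y /lc/cb.
have h (i : 'I_K.+1) : exists j : 'I_(size (words S K)),
    let w := nth [::] (words S K) j in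
    walk_in a V x w /\ foldr a x w = nth x l i.
  have [|w wK [wV wi]] := lb (nth x l i); first by rewrite /= mem_nth// sl.
  have wi' : (index w (words S K) < size (words S K))%N by rewrite index_mem.
  by exists (Ordinal wi'); rewrite /= nth_index.
have [f hf] := choice h.
exists [ffun i => f i]; rewrite /realizes /pattern_word; split=> [i|i j ij]; rewrite !ffunE.
  by case: (hf i).
rewrite (hf i).2 (hf j).2 => /eqP; rewrite nth_uniq ?sl// => /eqP/val_inj.
exact/eqP.
Qed.

Lemma realizes_not_components_le (G : groupType) (S : seq G) (T : choiceType)
    (a : G -> T -> T) (V : set T) (K : nat) (p : pattern S K) x :
  realizes a V p x -> ~ card_le [set y | induced_conn S a V x y] K.
Proof.
move=> [pV pI]; pose f i := foldr a x (pattern_word p i).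
apply: (@card_le_pigeonhole _ _ _ [seq f i | i <- enum 'I_K.+1]).
- rewrite map_inj_uniq ?enum_uniq// => i j; apply: contraPP => /eqP ij.
  exact: pI.
- move=> y /mapP[i _ ->]; apply: walk_conn => //; exact: pattern_word_sub.
- by rewrite size_map size_enum_ord.
Qed.

(** * Ultrafilters and extended actions *)

Lemma betaX_ext (X : Type) (w w' : betaX X) :
  (forall A, ufsets w A <-> ufsets w' A) -> w = w'.
Proof.
case: w w' => [F PF] [F' PF'] /= FF'.
have {FF'} FF' : F = F' by apply/funext => A; exact/propext.
by subst F'; congr MkBeta; exact: Prop_irrelevance.
Qed.

Lemma ufsets_setI (X : Type) (w : betaX X) (A B : set X) :
  ufsets w (A `&` B) <-> ufsets w A /\ ufsets w B.
Proof.
have [_ _ wI ws _] := ufP w; split=> [wAB|[wA wB]]; last exact: wI.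
by split; apply: ws wAB => x [].
Qed.

Lemma ufsets_sub (X : Type) (w : betaX X) (A B : set X) :
  A `<=` B -> ufsets w A -> ufsets w B.
Proof. by have [_ _ _ ws _] := ufP w; exact: ws. Qed.

Lemma ufsetsT (X : Type) (w : betaX X) : ufsets w setT.
Proof. by have [] := ufP w. Qed.

Lemma ufsets0 (X : Type) (w : betaX X) : ~ ufsets w set0.
Proof. by have [] := ufP w. Qed.

Lemma ufsets_setC (X : Type) (w : betaX X) (A : set X) :
  ufsets w (~` A) <-> ~ ufsets w A.
Proof.
have [_ w0 wI ws wC] := ufP w; split=> [wA wA'|]; last by case: (wC A).
by apply: w0; rewrite -(setICr A); exact: wI.
Qed.

Lemma ufsets_setU (X : Type) (w : betaX X) (A B : set X) :
  ufsets w (A `|` B) <-> ufsets w A \/ ufsets w B.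
Proof.
split=> [wAB|[|]].
- apply: contrapT => /not_orP[/ufsets_setC wA /ufsets_setC wB].
  apply: (@ufsets0 _ w); have : ufsets w ((A `|` B) `&` (~` A `&` ~` B)).
    by apply/ufsets_setI; split=> //; apply/ufsets_setI.
  by rewrite -setCU setICr.
- by apply: ufsets_sub => x Ax; left.
- by apply: ufsets_sub => x Bx; right.
Qed.

Lemma ufsets_nonempty (X : Type) (w : betaX X) (A : set X) :
  ufsets w A -> A !=set0.
Proof.
move=> wA; apply/set0P/negP => /eqP A0.
by apply: (@ufsets0 _ w); rewrite -A0.
Qed.

Lemma ufsets_forall (X : Type) (I : finType) (w : betaX X) (A : I -> set X) :
  (forall i, ufsets w (A i)) <-> ufsets w [set x | forall i, A i x].
Proof.
split=> [wA|wA i]; last by apply: ufsets_sub wA => x.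
have H (l : seq I) : ufsets w [set x | forall i, i \in l -> A i x].
  elim: l => [|i l IH]; first by apply: ufsets_sub (ufsetsT w) => x.
  have := (ufsets_setI w _ _).2 (conj (wA i) IH).
  by apply: ufsets_sub => x [Ax lx] j; rewrite inE => /predU1P[->|/lx].
by apply: ufsets_sub (H (enum I)) => x Ax i; apply: Ax; rewrite mem_enum.
Qed.

Lemma ultrafilter_extending (X : pointedType) (B : set (set X)) :
  (exists A, B A) -> (forall A, B A -> A !=set0) ->
  (forall A A', B A -> B A' -> exists2 C, B C & C `<=` A `&` A') ->
  exists w : betaX X, forall A, B A -> ufsets w A.
Proof.
move=> [A0 BA0] Bn0 BI.
pose F := [set A | exists2 C, B C & C `<=` A].
have FF : ProperFilter F.
  split; first by move=> [C /Bn0[x Cx] /(_ _ Cx)].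
  split; first by exists A0.
  - move=> A A' [C BC CA] [C' BC' CA']; have [D BD DCC'] := BI _ _ BC BC'.
    by exists D => // x /DCC'[/CA ? /CA' ?].
  - by move=> A A' AA' [C BC CA]; exists C => // x /CA/AA'.
have [U [UU FU]] := ultraFilterLemma FF.
have PU : is_ultrafilter U.
  split.
  - exact: filterT.
  - exact: filter_not_empty.
  - by move=> A A' UA UA'; exact: filterI.
  - by move=> A A' AA' UA; exact: filterS UA.
  - by move=> A; exact: in_ultra_setVsetC.
by exists (MkBeta PU) => A BA; apply: FU; exists A.
Qed.

(** For a bijection, the images of the sets in [w] are the sets whose preimage is in [w]; these form
    an ultrafilter, so [ext] never takes its fallback branch. *)
Lemma ext_ufsets (X : Type) (f g : X -> X) : cancel f g -> cancel g f ->
  forall (w : betaX X) B, ufsets (ext f w) B <-> ufsets w (f @^-1` B).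
Proof.
move=> fK gK w B.
have img A : image_filter f w A <-> ufsets w (f @^-1` A).
  split=> [[C wC ->]|wA]; first by apply: ufsets_sub wC => x Cx; exists x.
  exists (f @^-1` A) => //; apply/seteqP; split=> [x Ax|x [y fAy <-]//].
  by exists (g x); rewrite /preimage/= gK.
rewrite /ext; case: pselect => [h|[]] /=; first exact: img.
split.
- by apply/img; exact: ufsetsT.
- by move=> /img; exact: ufsets0.
- by move=> A A' /img wA /img wA'; apply/img/ufsets_setI.
- by move=> A A' AA' /img wA; apply/img; apply: ufsets_sub wA => x /AA'.
- move=> A; have [wA|nwA] := pselect (ufsets w (f @^-1` A)).
    by left; exact/img.
  by right; apply/img/ufsets_setC.
Qed.

(** * The extended action along words *)

Lemma actK (G : groupType) (X : Type) (act : G -> X -> X) (g : G) :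
  is_action act -> cancel (act g) (act (monoid.inv g)).
Proof. by move=> [act1 actM] x; rewrite -actM monoid.mulVg act1. Qed.

Lemma actVK (G : groupType) (X : Type) (act : G -> X -> X) (g : G) :
  is_action act -> cancel (act (monoid.inv g)) (act g).
Proof. by move=> [act1 actM] x; rewrite -actM monoid.mulgV act1. Qed.

Lemma ext_act_ufsets (G : groupType) (X : Type) (act : G -> X -> X) (g : G) :
  is_action act -> forall (w : betaX X) B,
  ufsets (ext (act g) w) B <-> ufsets w (act g @^-1` B).
Proof.
by move=> actA; apply: ext_ufsets; [exact: actK|exact: actVK].
Qed.

Local Notation extact act := (fun s => ext (act s)).

Lemma ext_walk_ufsets (G : groupType) (X : Type) (act : G -> X -> X)
    (l : seq G) : is_action act -> forall (w : betaX X) B,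
  ufsets (foldr (extact act) w l) B <-> ufsets w [set x | B (foldr act x l)].
Proof.
move=> actA w; elim: l => [|s l IH] B //=.
rewrite ext_act_ufsets//; exact: IH.
Qed.

(** A walk imposes finitely many membership conditions, and an ultrafilter commutes with finite
    conjunctions. *)
Lemma ext_walk_in (G : groupType) (X : Type) (act : G -> X -> X)
    (l : seq G) : is_action act -> forall (w : betaX X) A,
  walk_in (extact act) (U_ A) w l <-> ufsets w [set x | walk_in act A x l].
Proof.
move=> actA w A; elim: l => [|s l IH] /=.
  split=> [[wA _]|wA]; first by apply: ufsets_sub wA => x.
  by split=> //; apply: ufsets_sub wA => x [].
have E := ext_walk_ufsets (s :: l) actA w A.
rewrite IH; split=> [[wA wl]|].
  by apply: (ufsets_setI w _ _).2; split=> //; exact: E.1.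
by move=> /(ufsets_setI w _ _).1 [wA wl]; split=> //; exact: E.2.
Qed.

(* If [A] is maximal with [f A] disjoint from [A], then the sets [A], [f A],
   [f^-1 A] cover all points moved by [f], and each of them is disjoint from its
   own image. *)
Lemma ext_fixed (X : Type) (f g : X -> X) (w : betaX X) :
  cancel f g -> cancel g f ->
  ext f w = w -> ufsets w [set x | f x = x].
Proof.
move=> fK gK fw.
pose P := [set A : set X | forall x, A x -> ~ A (f x)].
have [|A [PA Amax]] := @Zorn_bigcup X P.
  move=> F FP Ftot x [A FA Ax] [B FB Bfx].
  have [AB|BA] := Ftot A B FA FB; first exact: (FP B FB x (AB _ Ax)).
  exact: (FP A FA x Ax (BA _ Bfx)).
(* If [B] belongs to the fixed point [w], so does its preimage under [f], and the two sets must
   meet. *)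
have nowhere B : (forall x, B x -> ~ B (f x)) -> ~ ufsets w B.
  move=> PB wB; have : ufsets w (f @^-1` B) by rewrite -(ext_ufsets fK gK) fw.
  move=> wB'; have := (ufsets_setI w _ _).2 (conj wB wB').
  by move/ufsets_nonempty => [x [Bx Bfx]]; exact: (PB x).
have cover x : f x = x \/ (A x \/ A (f x) \/ A (g x)).
  have [?|ne] := pselect (f x = x); [by left|right].
  have [?|nAx] := pselect (A x); [by left|right].
  have [?|nAf] := pselect (A (f x)); [by left|right].
  apply: contrapT => nAg; apply: (Amax (A `|` [set x])).
    split; last by move=> /(_ x (or_intror erefl)).
    by move=> y Ay; left.
  move=> y [Ay|->] [|]; rewrite /=.
  - exact: PA.
  - by move=> fyx; apply: nAg; rewrite -fyx fK.
  - by [].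
  - by [].
have : ufsets w (f @^-1` A `|` g @^-1` A `|` A `|` [set x | f x = x]).
  apply: ufsets_sub (ufsetsT w) => x _ /=.
  have := cover x; rewrite /setU/=; tauto.
case/ufsets_setU => // /ufsets_setU[/ufsets_setU[]|] => /nowhere => h; exfalso.
- by apply: h => x; exact: PA.
- by apply: h => x Agx; rewrite /preimage/= fK => Ax; apply: PA Agx _; rewrite gK.
- by apply: h; exact: PA.
Qed.

Lemma walkE (G : groupType) (X : Type) (act : G -> X -> X) (l : seq G) x :
  is_action act -> foldr act x l = act (foldr (@monoid.mul G) (@monoid.one G) l) x.
Proof.
by move=> [act1 actM]; elim: l => [|s l /= ->]; rewrite /= ?act1 ?actM.
Qed.

(** If two words agree at [w], the quotient [h] of their products fixes [w], so by [ext_fixed] the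
    fixed points of [h] form a set in [w]; the two words agree at these points. *)
Lemma ext_walk_eq (G : groupType) (X : Type) (act : G -> X -> X)
    (l l' : seq G) (w : betaX X) : is_action act ->
  foldr (extact act) w l = foldr (extact act) w l' <->
  ufsets w [set x | foldr act x l = foldr act x l'].
Proof.
move=> actA; split=> [ll'|wE]; last first.
  apply: betaX_ext => B; rewrite !ext_walk_ufsets//; split=> wB.
    by have := (ufsets_setI w _ _).2 (conj wE wB); apply: ufsets_sub => x [/= ->].
  by have := (ufsets_setI w _ _).2 (conj wE wB); apply: ufsets_sub => x [/= <-].
pose p k := foldr (@monoid.mul G) (@monoid.one G) k.
pose h := monoid.mul (monoid.inv (p l')) (p l).
have [act1 actM] := actA.
have : ufsets w [set x | act h x = x].
  apply: (ext_fixed (actK h actA) (actVK h actA)).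
  apply: betaX_ext => B; rewrite ext_act_ufsets//.
  pose B' := act (monoid.inv (p l')) @^-1` B.
  have := ext_walk_ufsets l actA w B'; rewrite ll' ext_walk_ufsets//.
  rewrite (_ : [set x | B' (foldr act x l')] = B); last first.
    by apply/funext => x; rewrite /B' /preimage/= walkE// actK.
  rewrite (_ : [set x | B' (foldr act x l)] = act h @^-1` B).
    by move=> [h1 h2]; split.
  by apply/funext => x; rewrite /B' /preimage/= walkE// -actM.
apply: ufsets_sub => x /= hx; rewrite (walkE l x actA) (walkE l' x actA).
have {hx} hx : act (monoid.inv (p l')) (act (p l) x) = x by rewrite -actM.
by rewrite -(actVK (p l') actA (act (p l) x)) hx.
Qed.

(** An oversized component realizes a pattern at some [w]. This is a finite conjunction of
    conditions, so the realizers in [X] form a set in [w], and one of them contradicts the bound for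
    [A]. *)
Lemma components_le_clopen (G : groupType) (S : seq G) (X : choiceType)
    (act : G -> X -> X) (A : set X) (K : nat) : is_action act ->
  components_le S act A K -> components_le S (extact act) (U_ A) K.
Proof.
move=> actA AK; apply: contrapT => /not_components_le[w [wA [p [pV pI]]]].
have : ufsets w [set x | realizes act A p x].
  have h1 : ufsets w [set x | forall i, walk_in act A x (pattern_word p i)].
    by apply/ufsets_forall => i; exact/ext_walk_in.
  have h2 : ufsets w [set x | forall ij : 'I_K.+1 * 'I_K.+1, ij.1 != ij.2 ->
      foldr act x (pattern_word p ij.1) <> foldr act x (pattern_word p ij.2)].
    apply/ufsets_forall => -[i j] /=.
    have [->|ij] := eqVneq i j; first by apply: ufsets_sub (ufsetsT w) => x.
    have /ufsets_setC := contra_not (ext_walk_eq _ _ _ actA).2 (pI i j ij).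
    by apply: ufsets_sub => x.
  have := (ufsets_setI w _ _).2 (conj h1 h2); apply: ufsets_sub => x [g1 g2].
  by split=> // i j; exact: (g2 (i, j)).
move=> /ufsets_nonempty[x xp]; apply: (realizes_not_components_le xp).
(* Every walk visits its start, so [x] lies in [A]. *)
by apply: AK; have := xp.1 ord0; elim: (pattern_word p ord0) => [|s l IH] [].
Qed.

(** * Closed sets and compactness of beta X *)

Lemma closedB_mem (X : Type) (C : set (betaX X)) (w : betaX X) :
  openB (~` C) -> (forall A, C `<=` U_ A -> ufsets w A) -> C w.
Proof.
move=> Co wC; apply: contrapT => /Co[A [wA AC]].
have : ufsets w (~` A).
  by apply: wC => w' Cw'; apply/ufsets_setC => w'A; exact: (AC w').
by move/ufsets_setC.
Qed.

(** If every clopen set containing [C] fails the bound, one pattern is realized in all of them, and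
    its sets of realizers form a filter base. An ultrafilter containing them realizes the pattern
    inside [C], a contradiction. *)
Lemma components_le_closed (G : groupType) (S : seq G) (X : pointedType)
    (act : G -> X -> X) (C : set (betaX X)) (K : nat) : is_action act ->
  openB (~` C) -> components_le S (extact act) C K ->
  exists A, C `<=` U_ A /\ components_le S act A K.
Proof.
move=> actA Co CK; apply: contrapT => nA.
have real A : C `<=` U_ A -> exists p : pattern S K, exists x, realizes act A p x.
  move=> CA; have [|x [_ [p xp]]] := @not_components_le _ S _ act A K.
    by move=> AK; apply: nA; exists A.
  by exists p, x.
(* If each pattern [q] failed for some [F q], the intersection of these finitely many sets would
   realize no pattern. *)
have [p pC] : exists p : pattern S K,
    forall A, C `<=` U_ A -> exists x, realizes act A p x.
  apply: contrapT => /forallNP np.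
  have {}np (p : pattern S K) : exists A, C `<=` U_ A /\ ~ exists x, realizes act A p x.
    by have /existsNP[A /not_implyP ?] := np p; exists A.
  have [F hF] := choice np.
  have [|p [x [xV xI]]] := real [set x | forall q : pattern S K, F q x].
    by move=> w Cw; apply/ufsets_forall => p; exact: (hF p).1.
  apply: (hF p).2; exists x; split=> // i.
  by apply: walk_in_sub (xV i) => y; exact.
pose B := [set D : set X | exists2 A, C `<=` U_ A & D = [set x | realizes act A p x]].
have [||D D' [A CA ->] [A' CA' ->]|w wB] := @ultrafilter_extending X B.
- by exists [set x | realizes act setT p x], setT => // w _; exact: ufsetsT.
- by move=> D [A /pC[x xp] ->]; exists x.
- exists [set x | realizes act (A `&` A') p x].
    by exists (A `&` A') => // w Cw; apply/ufsets_setI; split; [exact: CA|exact: CA'].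
  by move=> x [xV xI]; split; split=> // i; apply: walk_in_sub (xV i) => y [].
have wC A i : C `<=` U_ A -> walk_in (extact act) (U_ A) w (pattern_word p i).
  move=> CA; apply/ext_walk_in => //.
  have : ufsets w [set x | realizes act A p x] by apply: wB; exists A.
  by apply: ufsets_sub => x [xV _]; exact: xV.
(* The walks stay in [C] because a closed set is the intersection of the clopen sets containing it;
   two equal ends at [w] would be equal at some realizer in [X]. *)
have wr : realizes (extact act) C p w.
  split=> [i|i j ij /(ext_walk_eq _ _ _ actA) wE].
    have : forall A, C `<=` U_ A -> walk_in (extact act) (U_ A) w (pattern_word p i).
      by move=> A; exact: wC.
    elim: (pattern_word p i) => [|s l IH] wl.
      by split=> //; apply: closedB_mem Co _ => A /wl[].
    split; first by apply: closedB_mem Co _ => A /wl[].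
    by apply: IH => A /wl[].
  have wT : ufsets w [set x | realizes act setT p x].
    by apply: wB; exists setT => // w' _; exact: ufsetsT.
  have := (ufsets_setI w _ _).2 (conj wE wT).
  by move=> /ufsets_nonempty[x [/= xE [_ /(_ i j ij)]]].
apply: (realizes_not_components_le wr); apply: CK.
by have := wr.1 ord0; elim: (pattern_word p ord0) => [|s l IH] [].
Qed.

(** Without a finite subcover, the sets [A] with [U_ A] containing [C] minus a finite union form a
    filter base; an ultrafilter extending it lies in [C] but in no [O i]. *)
Lemma compactB_closed (X : pointedType) (C : set (betaX X)) :
  openB (~` C) -> compactB C.
Proof.
move=> Co I O Oo CO; apply: contrapT => nl.
pose U (l : list I) := \bigcup_(i in [set i | List.In i l]) O i.
pose B := [set A : set X | exists l : list I, C `\` U l `<=` U_ A].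
have [||A A' [l Al] [l' Al']|w wB] := @ultrafilter_extending X B.
- by exists setT, [::] => w _; exact: ufsetsT.
- move=> A [l lA]; have /existsNP[w /not_implyP[Cw Uw]] : ~ C `<=` U l.
    by move=> Cl; apply: nl; exists l.
  by apply: (@ufsets_nonempty _ w); exact: lA.
- exists (A `&` A') => //; exists (l ++ l') => w [Cw Uw].
  apply/ufsets_setI; split.
    apply: Al; split=> // -[i li Oi]; apply: Uw; exists i => //=.
    by apply/List.in_app_iff; left.
  apply: Al'; split=> // -[i li Oi]; apply: Uw; exists i => //=.
  by apply/List.in_app_iff; right.
have Cw : C w.
  by apply: closedB_mem Co _ => A CA; apply: wB; exists [::] => w' [/CA].
have [i _ Oiw] := CO _ Cw; have [A [wA AO]] := Oo i w Oiw.
have : ufsets w (~` A).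
  apply: wB; exists [:: i] => w' [Cw' Uw']; apply/ufsets_setC => w'A.
  by apply: Uw'; exists i; [left|exact: AO].
by move/ufsets_setC.
Qed.

Lemma openB_U (X : Type) (A : set X) : openB (U_ A).
Proof. by move=> w wA; exists A; split. Qed.

Lemma setC_U (X : Type) (A : set X) : ~` U_ A = U_ (~` A).
Proof. by apply/seteqP; split=> w /ufsets_setC. Qed.

Lemma openB_setI (X : Type) (O O' : set (betaX X)) :
  openB O -> openB O' -> openB (O `&` O').
Proof.
move=> Oo Oo' w [/Oo[A [wA AO]] /Oo'[A' [wA' AO']]]; exists (A `&` A').
by split; [exact/ufsets_setI|move=> w' /ufsets_setI[/AO ? /AO' ?]].
Qed.

Lemma openB_bigcup (X I : Type) (O : I -> set (betaX X)) :
  (forall i, openB (O i)) -> openB (\bigcup_i O i).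
Proof.
by move=> Oo w [i _ /Oo[A [wA AO]]]; exists A; split=> // w' /AO; exists i.
Qed.

Lemma openBT (X : Type) : openB (@setT (betaX X)).
Proof. by move=> w _; exists setT; split=> //; exact: ufsetsT. Qed.

Definition principal (X : Type) (x : X) : betaX X :=
  MkBeta (principal_ultrafilter x).

Lemma U_sub (X : Type) (A B : set X) : U_ A `<=` U_ B -> A `<=` B.
Proof. by move=> AB x Ax; exact: (AB (principal x)). Qed.

(** * Finitely additive means *)

Section mean.
Context (R : realType) (X : Type) (mu : set X -> R) (muM : is_mean mu).
Local Open Scope ring_scope.

Lemma mean_ge0 A : 0 <= mu A. Proof. by have [/(_ A)/andP[]] := muM. Qed.

Lemma mean_le1 A : mu A <= 1. Proof. by have [/(_ A)/andP[]] := muM. Qed.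

Lemma meanT : mu setT = 1. Proof. by have [_ []] := muM. Qed.

Lemma meanU A B : A `&` B = set0 -> mu (A `|` B) = mu A + mu B.
Proof. by have [_ [_]] := muM; exact. Qed.

Lemma mean0 : mu set0 = 0.
Proof.
have := @meanU set0 set0 (setI0 _); rewrite setU0 => /eqP.
by rewrite -[X in X == _]addr0 => /eqP/addrI.
Qed.

Lemma meanID A B : mu A = mu (A `&` B) + mu (A `&` ~` B).
Proof.
rewrite -meanU; first by rewrite -setIUr setUCr setIT.
by rewrite setIACA setICr setI0.
Qed.

Lemma mean_mono A B : A `<=` B -> mu A <= mu B.
Proof.
by move=> AB; rewrite (meanID B A) (setIidr AB) lerDl mean_ge0.
Qed.

Lemma mean_subU A B : mu (A `|` B) <= mu A + mu B.
Proof.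
rewrite (meanID (A `|` B) A) lerD//; apply: mean_mono; first by move=> x [].
by move=> x [[]].
Qed.

Lemma meanC A : mu (~` A) = 1 - mu A.
Proof. by rewrite -meanT (meanID setT A) !setTI addrAC subrr add0r. Qed.

Lemma mean_bigU (I : Type) (l : seq I) (A : I -> set X) :
  mu (\big[setU/set0]_(i <- l) A i) <= \sum_(i <- l) mu (A i).
Proof.
elim: l => [|i l IH]; first by rewrite !big_nil mean0.
by rewrite !big_cons; apply: le_trans (mean_subU _ _) _; rewrite lerD2l.
Qed.

End mean.

(** * The regular measure of a mean *)

Definition clopen_inner (R : realType) (X : Type) (mu : set X -> R)
    (O : set (betaX X)) : \bar R :=
  ereal_sup [set (mu A)%:E | A in [set A | U_ A `<=` O]].

Definition mean_outer (R : realType) (X : Type) (mu : set X -> R)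
    (E : set (betaX X)) : \bar R :=
  ereal_inf [set clopen_inner mu O | O in [set O | openB O /\ E `<=` O]].

Section mean_measure.
Context (R : realType) (X : pointedType) (mu : set X -> R) (muM : is_mean mu).
Local Notation inner := (clopen_inner mu).
Local Notation outer := (mean_outer mu).
Local Open Scope ereal_scope.

Lemma inner_ub A O : U_ A `<=` O -> (mu A)%:E <= inner O.
Proof. by move=> AO; apply: ereal_sup_ubound; exists A. Qed.

Lemma inner_le_fin O (r : \bar R) :
  (forall A, U_ A `<=` O -> (mu A)%:E <= r) -> inner O <= r.
Proof. by move=> h; apply: ge_ereal_sup => _ [A AO <-]; exact: h. Qed.

Lemma inner_U A : inner (U_ A) = (mu A)%:E.
Proof.
apply/eqP; rewrite eq_le inner_ub// andbT; apply: inner_le_fin => B /U_sub BA.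
by rewrite lee_fin mean_mono.
Qed.

Lemma U_set0 : U_ (@set0 X) = set0.
Proof. by apply/seteqP; split=> // w; exact: ufsets0. Qed.

Lemma inner_ge0 O : 0 <= inner O.
Proof. by have := @inner_ub set0 O; rewrite U_set0 mean0//; apply. Qed.

Lemma inner_le1 O : inner O <= 1.
Proof. by apply: inner_le_fin => A _; rewrite lee_fin mean_le1. Qed.

Lemma inner_mono O O' : O `<=` O' -> inner O <= inner O'.
Proof. by move=> OO'; apply: inner_le_fin => A AO; apply: inner_ub => w /AO/OO'. Qed.

(** By compactness finitely many clopen pieces cover [U_ A]; grouped by the index [n] of the set
    [O n] containing them, they reduce the claim to finite subadditivity of the mean. *)
Lemma inner_sigma_subadditive (O : nat -> set (betaX X)) :
  (forall n, openB (O n)) -> inner (\bigcup_n O n) <= \sum_(n <oo) inner (O n).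
Proof.
move=> Oo; apply: inner_le_fin => A AO.
(* The clopen set of [p.2] counts only if it lies in [O p.1]; otherwise [P p] is empty. *)
pose P (p : nat * set X) := [set w | U_ p.2 `<=` O p.1 /\ U_ p.2 w].
have Ac : compactB (U_ A) by apply: compactB_closed; rewrite setC_U; exact: openB_U.
have [||l lA] := Ac _ P.
- by move=> [n B] w [BO wB]; exists B; split=> // w' w'B.
- by move=> w /AO[n _ /Oo[B [wB BO]]]; exists (n, B).
pose N := (\max_(p <- l) p.1).+1.
pose B n := [set x | exists2 p, List.In p l /\ p.1 = n & P p (principal x)].
have BO n : U_ (B n) `<=` O n.
  have : forall l', U_ [set x | exists2 p, List.In p l' /\ p.1 = n &
      P p (principal x)] `<=` O n.
    elim=> [|p l' IH] w; first by move=> /ufsets_nonempty[x [p []]].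
    move=> wU; have : ufsets w ([set x | p.1 = n /\ P p (principal x)] `|`
        [set x | exists2 p, List.In p l' /\ p.1 = n & P p (principal x)]).
      apply: ufsets_sub wU => x [q [[<-|ql'] qn] qx]; first by left.
      by right; exists q.
    case/ufsets_setU; last exact: IH.
    move=> wp; have [x [pn [pO _]]] := ufsets_nonempty wp.
    by rewrite -pn; apply: pO; apply: ufsets_sub wp => y [_ []].
  exact.
apply: (@le_trans _ _ (\sum_(0 <= n < N) (mu (B n))%:E)).
  rewrite sumEFin lee_fin; apply: le_trans (mean_bigU muM _ _).
  apply: mean_mono => // x Ax; have [p pl px] := lA (principal x) Ax.
  have pN : (p.1 < N)%N.
    rewrite ltnS; move: pl; rewrite /=; elim: (l) => [//|q l' IH] /=.
    by rewrite big_cons => -[->|/IH]; rewrite leq_max ?leqnn// => ->; rewrite orbT.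
  rewrite -bigcup_seq; exists p.1 => /=; last by exists p.
  by rewrite mem_index_iota pN.
apply: (@le_trans _ _ (\sum_(0 <= n < N) inner (O n))).
  by apply: lee_sum => n _; exact: inner_ub.
by apply: nneseries_lim_ge => n *; exact: inner_ge0.
Qed.

Lemma le_outer E E' : E `<=` E' -> outer E <= outer E'.
Proof.
move=> EE'; apply: ereal_inf_le_tmp => _ [ O [Oo EO] <-].
by exists O => //; split=> // w /EE'/EO.
Qed.

Lemma outer_lb E O : openB O -> E `<=` O -> outer E <= inner O.
Proof. by move=> Oo EO; apply: ereal_inf_lbound; exists O. Qed.

Lemma outer_open O : openB O -> outer O = inner O.
Proof.
move=> Oo; apply/eqP; rewrite eq_le outer_lb//=.
by apply: le_ereal_inf_tmp => _ [ O' [_ OO'] <-]; exact: inner_mono.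
Qed.

Lemma outer_U A : outer (U_ A) = (mu A)%:E.
Proof. by rewrite outer_open ?inner_U//; exact: openB_U. Qed.

Lemma outer_ge0 E : 0 <= outer E.
Proof. by apply: le_ereal_inf_tmp => _ [ O _ <-]; exact: inner_ge0. Qed.

Lemma outer_fin E : outer E \is a fin_num.
Proof.
rewrite ge0_fin_numE ?outer_ge0//.
apply: le_lt_trans (outer_lb (@openBT X) (@subsetT _ E)) _.
apply: le_lt_trans (inner_le1 _) _; exact: ltry.
Qed.

Lemma outer0 : outer set0 = 0.
Proof. by rewrite -U_set0 outer_U mean0. Qed.

Lemma outerT : outer setT = 1.
Proof.
have -> : [set: betaX X] = U_ setT.
  by apply/seteqP; split=> // w _; exact: ufsetsT.
by rewrite outer_U meanT.
Qed.

Lemma outer_adherent E (e : R) : (0 < e)%R ->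
  exists O, [/\ openB O, E `<=` O & inner O <= outer E + e%:E].
Proof.
move=> e0; have [_ [ O [Oo EO] <-] /ltW] := lb_ereal_inf_adherent e0 (outer_fin E).
by exists O.
Qed.

Lemma outer_sigma_subadditive : sigma_subadditive outer.
Proof.
move=> F; apply/lee_addgt0Pr => e e0.
have e2 n : (0 < e / (2 ^ n.+1)%:R)%R by rewrite divr_gt0// ltr0n expn_gt0.
have [ O hO] := choice (fun n => outer_adherent (F n) (e2 n)).
apply: (@le_trans _ _ (inner (\bigcup_n O n))).
  apply: outer_lb; first by apply: openB_bigcup => n; have [] := hO n.
  by move=> w [n _ wF]; exists n => //; have [_ + _] := hO n; exact.
apply: le_trans (inner_sigma_subadditive _) _; first by move=> n; have [] := hO n.
apply: (@le_trans _ _ (\sum_(n <oo) (outer (F n) + (e / (2 ^ n.+1)%:R)%:E))).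
  apply: lee_nneseries => n *; first exact: inner_ge0.
  by have [] := hO n.
by apply: epsilon_trick => [n|]; [exact: outer_ge0|exact: ltW].
Qed.

(** This is the Caratheodory condition for open sets. If [U_ A] lies in both [O] and an open [P]
    containing [E], then [P] minus [U_ A] is open and covers the part of [P] outside [O]; its clopen
    subsets are disjoint from [U_ A], so additivity of the mean applies. *)
Lemma outer_openI E O : openB O -> outer (E `&` O) + outer (E `&` ~` O) <= outer E.
Proof.
move=> Oo; apply: le_ereal_inf_tmp => _ [P [Po EP] <-].
apply: (@le_trans _ _ (inner (P `&` O) + outer (P `&` ~` O))).
  apply: leeD; last by apply: le_outer; exact: setSI.
  by apply: outer_lb; [exact: openB_setI|exact: setSI].
rewrite -leeBrDr ?outer_fin//; apply: inner_le_fin => A AP.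
rewrite leeBrDr ?outer_fin// addeC -leeBrDr//.
apply: (@le_trans _ _ (inner (P `&` ~` U_ A))).
  apply: outer_lb; first by apply: openB_setI => //; rewrite setC_U; exact: openB_U.
  by move=> w [Pw Ow]; split=> // /AP[].
apply: inner_le_fin => B BP; rewrite leeBrDr// -EFinD -meanU//; last first.
  apply/seteqP; split=> // x [Bx Ax].
  by have [_] := BP (principal x) Bx; apply.
by apply: inner_ub => w /ufsets_setU[/BP[]|/AP[]].
Qed.

End mean_measure.

(** Open sets satisfy the Caratheodory condition, hence so do Borel sets. Outer regularity is built
    into [mean_outer]; inner regularity follows by taking complements, closed sets being compact. *)
Lemma mean_extension (R : realType) (X : pointedType) (mu : set X -> R) :
  is_mean mu -> exists nu : probability (betaXm X) R,
    regular_measure nu /\ (forall B : set (betaXm X), nu B = mean_outer mu B).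
Proof.
move=> muM.
pose om : outer_measure R (betaX X) :=
  HB.pack (mean_outer mu) (isOuterMeasure.Build R (betaX X) (mean_outer mu)
    (outer0 muM) (outer_ge0 muM) (@le_outer _ _ mu)
    (outer_sigma_subadditive muM)).
have sub (B : set (betaXm X)) : measurable B -> om.-cara.-measurable B.
  apply: smallest_sub.
    split; first exact: measurable0.
    - by move=> A mA; rewrite setTD; exact: measurableC.
    - by move=> A mA; exact: bigcupT_measurable.
  by move=> O Oo; apply: le_caratheodory_measurable => E; exact: outer_openI.
have additive : semi_sigma_additive (mean_outer mu : set (betaXm X) -> \bar R).
  move=> F mF tF mUF; apply: (@caratheodory_measure_sigma_additive _ _ om) => //.
  - by move=> i; exact: sub.
  - exact: sub.
pose nu0 : measure (betaXm X) R :=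
  HB.pack (mean_outer mu : set (betaXm X) -> \bar R)
   (isMeasure.Build _ (betaXm X) R (mean_outer mu : set (betaXm X) -> \bar R)
      (outer0 muM) (outer_ge0 muM) additive).
pose nu : probability (betaXm X) R :=
  HB.pack (mean_outer mu : set (betaXm X) -> \bar R) (Measure.on nu0)
    (Measure_isProbability.Build _ (betaXm X) R nu0 (outerT muM)).
exists nu; split=> // B mB; split.
  congr ereal_inf; apply/seteqP; split=> _ [ O [Oo BO] <-]; exists O => //=.
  - by rewrite outer_open.
  - by rewrite -(outer_open mu Oo).
have nuE (E : set (betaXm X)) : nu E = mean_outer mu E by [].
apply/eqP; rewrite eq_le; apply/andP; split; last first.
  apply: ge_ereal_sup => _ [C [_ CB] <-]; exact: le_outer.
apply/lee_addgt0Pr => e e0.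
have [ O [Oo BO Oe]] := outer_adherent muM (~` B) e0.
have mO : measurable (O : set (betaXm X)) by apply: sub_sigma_algebra.
have CO : compactB (~` O) by apply: compactB_closed; rewrite setCK.
have CB : ~` O `<=` B by rewrite -[B]setCK; exact: subsetC.
apply: (@le_trans _ _ (nu (~` O) + e%:E)%E); last first.
  by rewrite leeD2r//; apply: ereal_sup_ubound; exists (~` O).
have := Oe; rewrite -outer_open// -!nuE.
rewrite -[B]setCK (probability_setC nu (measurableC mB)) (probability_setC nu mO).
rewrite setCK.
have fO := fin_num_measure nu _ mO; have fB := fin_num_measure nu _ (measurableC mB).
rewrite -(fineK fO) -(fineK fB) -!EFinD !lee_fin; lra.
Qed.

(** * Hyperfinite measures and hyperfinite means *)

Definition mean_hyperfinite (R : realType) (G : groupType) (X : Type)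
    (S : seq G) (act : G -> X -> X) (mu : set X -> R) : Prop :=
  forall eps : R, (0 < eps)%R ->
    exists Y : set X, (mu Y < eps)%R /\
      exists K : nat, (0 < K)%N /\ components_le S act (~` Y) K.

Lemma ext_preimage_U (G : groupType) (X : Type) (act : G -> X -> X) g
    (A : set X) : is_action act ->
  ext (act g) @^-1` (U_ A) = U_ (act g @^-1` A).
Proof. by move=> actA; apply/seteqP; split=> w /ext_act_ufsets; apply. Qed.

Lemma act_imageE (G : groupType) (X : Type) (act : G -> X -> X) g (A : set X) :
  is_action act -> act g @` A = act (monoid.inv g) @^-1` A.
Proof.
move=> actA; apply/seteqP; split=> [_ [x Ax <-]|x Ax]; first by rewrite /= actK.
by exists (act (monoid.inv g) x) => //; rewrite actVK.
Qed.

Lemma act_preimageE (G : groupType) (X : Type) (act : G -> X -> X) g (A : set X) :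
  is_action act -> act g @^-1` A = act (monoid.inv g) @` A.
Proof.
move=> actA; apply/seteqP; split=> [x Ax|_ [x Ax <-]]; last by rewrite /= actVK.
by exists (act g x) => //; rewrite actK.
Qed.

Lemma ext_actK (G : groupType) (X : Type) (act : G -> X -> X) g (w : betaX X) :
  is_action act -> ext (act (monoid.inv g)) (ext (act g) w) = w.
Proof.
move=> actA; apply: betaX_ext => A.
have cc : act g @^-1` (act (monoid.inv g) @^-1` A) = A.
  by apply/funext => x; rewrite /preimage/= actK.
split=> [/(ext_act_ufsets _ actA)/(ext_act_ufsets _ actA)|]; first by rewrite cc.
by rewrite -{1}cc => ?; apply/(ext_act_ufsets _ actA)/(ext_act_ufsets _ actA).
Qed.

Lemma ext_actVK (G : groupType) (X : Type) (act : G -> X -> X) g (w : betaX X) :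
  is_action act -> ext (act g) (ext (act (monoid.inv g)) w) = w.
Proof. by move=> /(ext_actK (monoid.inv g) w); rewrite monoid.invgK. Qed.

Lemma openB_ext (G : groupType) (X : Type) (act : G -> X -> X) g O :
  is_action act -> openB O -> openB (ext (act g) @^-1` O).
Proof.
move=> actA Oo w /Oo[A [wA AO]]; exists (act g @^-1` A); split.
  by rewrite -ext_preimage_U.
by rewrite -ext_preimage_U// => w' /AO.
Qed.

Lemma mean_outer_invariant (R : realType) (G : groupType) (X : pointedType)
    (act : G -> X -> X) (mu : set X -> R) g B : is_action act ->
  invariant_mean act mu -> mean_outer mu (ext (act g) @^-1` B) = mean_outer mu B.
Proof.
move=> actA muI.
have le h E : (mean_outer mu (ext (act h) @^-1` E) <= mean_outer mu E)%E.
  apply: le_ereal_inf_tmp => _ [U [Uo EU] <-].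
  apply: (@le_trans _ _ (clopen_inner mu (ext (act h) @^-1` U))).
    by apply: outer_lb; [exact: openB_ext|move=> w /EU].
  apply: inner_le_fin => A AU; rewrite -(muI h A); apply: inner_ub => w.
  rewrite act_imageE// -ext_preimage_U// => /AU.
  by rewrite /= ext_actVK.
apply/eqP; rewrite eq_le le/=.
have := le (monoid.inv g) (ext (act g) @^-1` B).
congr (mean_outer mu _ <= _)%E; apply/funext => w.
by rewrite /preimage/= ext_actVK.
Qed.

(** A nonnegative integral is a supremum over the simple functions below the integrand, so
    monotonicity holds for arbitrary functions, among them the degree of a set of edges. *)
Lemma le_integral_ge0 d (T : measurableType d) (R : realType)
    (nu : {measure set T -> \bar R}%R) (f g : T -> \bar R) :
  (forall x, 0 <= f x)%E -> (forall x, f x <= g x)%E ->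
  (\int[nu]_x f x <= \int[nu]_x g x)%E.
Proof.
move=> f0 fg; have g0 x : (0 <= g x)%E := le_trans (f0 x) (fg x).
rewrite !ge0_integralTE//; apply: ge_ereal_sup => _ [h hf <-].
by apply: ereal_sup_ubound; exists h => // x; exact: le_trans (hf x) (fg x).
Qed.

(** The Borel sigma-algebra of the product topology, which matches [BorelB2]; the product of the two
    Borel sigma-algebras could be smaller. *)
Definition betaX2m (X : pointedType) :=
  g_sigma_algebraType [set O : set (betaX X * betaX X) | openB2 O].

Lemma measurable_BorelB2 (X : pointedType) (W : set (betaX X * betaX X)) :
  BorelB2 W = measurable (W : set (betaX2m X)).
Proof. by []. Qed.

Lemma openB_measurable (X : pointedType) (O : set (betaXm X)) :
  openB O -> measurable O.
Proof. by move=> Oo; exact: sub_sigma_algebra. Qed.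

Lemma openB2_measurable (X : pointedType) (O : set (betaX2m X)) :
  openB2 O -> measurable O.
Proof. by move=> Oo; exact: sub_sigma_algebra. Qed.

(** The map sending [w] to [(w, ext (act g) w)] is continuous, so preimages of open sets are open;
    the sets with measurable preimage form a sigma-algebra. *)
Lemma measurable_graph_preimage (G : groupType) (X : pointedType)
    (act : G -> X -> X) g (W : set (betaX2m X)) : is_action act ->
  measurable W -> measurable ([set w | W (w, ext (act g) w)] : set (betaXm X)).
Proof.
move=> actA; pose T := [set W : set (betaX2m X) |
  measurable ([set w | W (w, ext (act g) w)] : set (betaXm X))].
suff : measurable `<=` T by move=> h /h.
apply: smallest_sub.
  split.
  - exact: measurable0.
  - move=> A mA; rewrite /T /= (_ : mkset _ =
      ~` [set w : betaXm X | A (w, ext (act g) w)]); last first.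
      by apply/seteqP; split=> w /=; rewrite /setD/=; tauto.
    exact: measurableC.
  - move=> A mA; rewrite /T /= (_ : mkset _ =
      \bigcup_n [set w : betaXm X | A n (w, ext (act g) w)]).
      exact: bigcupT_measurable.
    by apply/seteqP; split=> w [n _ An]; exists n.
move=> O Oo; apply: openB_measurable => w /Oo[A [B [/= wA [wB ABO]]]].
exists (A `&` act g @^-1` B); split.
  by apply/ufsets_setI; split=> //; exact/ext_act_ufsets.
move=> w' /ufsets_setI[w'A w'B]; apply: ABO; split=> //=.
exact/ext_act_ufsets.
Qed.

Lemma betaX_sep (X : Type) (w w' : betaX X) :
  w <> w' -> exists A, ufsets w A /\ ufsets w' (~` A).
Proof.
move=> ww'; apply: contrapT => /forallNP nA; apply: ww'; apply: betaX_ext => A.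
split=> wA; apply: contrapT => /ufsets_setC w'A; first by apply: (nA A).
by apply: (nA (~` A)); rewrite setCK.
Qed.

(** As beta X is Hausdorff, the diagonal and the graphs of the generators are closed. *)
Lemma measurable_graphing (G : groupType) (S : seq G) (X : pointedType)
    (act : G -> X -> X) : is_action act ->
  measurable (graphing_edges S act : set (betaX2m X)).
Proof.
move=> actA.
pose D : set (betaX2m X) := [set p | p.1 <> p.2].
have mD : measurable D.
  apply: openB2_measurable => -[w w'] /betaX_sep[A [wA w'A]].
  exists A, (~` A); split=> //; split=> // -[u u'] /= [uA u'A] /= uu'.
  by move/ufsets_setC: u'A; rewrite -[u']uu'.
pose N g : set (betaX2m X) := [set p | ext (act g) p.1 <> p.2].
have mN g : measurable (N g).
  apply: openB2_measurable => -[w w'] /betaX_sep[A [/= wA w'A]].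
  exists (act g @^-1` A), (~` A); split; first exact/ext_act_ufsets.
  split=> // -[u u'] /= [/(ext_act_ufsets _ actA) uA u'A] /= uu'.
  by move/ufsets_setC: u'A; rewrite -[u']uu'.
rewrite (_ : graphing_edges S act = D `&` \big[setU/set0]_(s <- S) ~` N s).
  apply: measurableI => //; apply: bigsetU_measurable => s _.
  exact: measurableC.
rewrite -bigcup_seq; apply/seteqP; split=> -[w w'] [/= ww' [s sS]].
  by move=> sw; split=> //; exists s => //= h; exact: h.
by move=> /contrapT sw; split=> //; exists s.
Qed.

(** * From hyperfinite measures to means *)

Lemma graphing_degree_finite (G : groupType) (S : seq G) (X : pointedType)
    (act : G -> X -> X) (W : set (betaX X * betaX X)) w :
  W `<=` graphing_edges S act -> finite_set [set w' | W (w, w')].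
Proof.
move=> WE; apply: (@sub_finite_set _ _ ((fun s => ext (act s) w) @` [set` S])).
  by move=> w' /WE[_ [s sS sw]]; exists s.
exact: finite_image.
Qed.

Lemma measure_hyperfinite_mean (R : realType) (G : groupType) (S : seq G)
    (X : pointedType) (act : G -> X -> X) (nu : probability (betaXm X) R) :
  is_action act -> regular_measure nu -> ext_invariant act nu ->
  hyperfinite_wrt S act nu ->
  exists mu : set X -> R,
    [/\ is_mean mu, invariant_mean act mu & mean_hyperfinite S act mu].
Proof.
move=> actA nuR nuI nuH; pose mu A := fine (nu (U_ A)).
have mU A : measurable (U_ A : set (betaXm X)) by exact: openB_measurable (@openB_U _ A).
have muE A : (mu A)%:E = nu (U_ A) by rewrite fineK// fin_num_measure.
exists mu; split.
- split=> [A|]; first by rewrite -!lee_fin muE measure_ge0 probability_le1.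
  split=> [|A B AB].
    apply: EFin_inj; rewrite muE (_ : U_ setT = setT) ?probability_setT//.
    by apply/seteqP; split=> // w _; exact: ufsetsT.
  apply: EFin_inj; rewrite EFinD !muE -measureU//.
    congr (nu _); apply/seteqP; split=> w; first by move=> /ufsets_setU.
    by move=> wAB; exact/ufsets_setU.
  apply/seteqP; split=> // w [wA wB].
  by apply: (@ufsets0 _ w); rewrite -AB; exact/ufsets_setI.
- move=> g A; apply: EFin_inj; rewrite !muE -(nuI g (U_ (act g @` A)))//.
  rewrite ext_preimage_U//; congr (nu (U_ _)); rewrite act_imageE//.
  by apply/funext => x; rewrite /preimage/= actK.
(* The factor 1/2 in the edge measure turns this [e / 2] into a bound [e] for the integral of the
   degree. *)
- move=> e e0; have e20 : (0 < e / 2)%R by rewrite divr_gt0.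
  have [K [W [mW WE Wsym We WK]]] := nuH _ e20.
  pose F : set (betaX2m X) := graphing_edges S act `\` W.
  have mF : measurable F by apply: measurableD => //; exact: measurable_graphing.
  (* [D] collects the endpoints of the edges missing from [W]; each has degree at least 1 in [F], so
     [nu D] is at most the integral of the degree. *)
  pose D : set (betaXm X) := \big[setU/set0]_(s <- S) [set w | F (w, ext (act s) w)].
  have mD : measurable D.
    by apply: bigsetU_measurable => s _; exact: measurable_graph_preimage.
  have DP w : D w <-> exists2 s, s \in S & F (w, ext (act s) w).
    by rewrite /D -bigcup_seq; split=> -[s sS Fs]; exists s.
  have De : (nu D < e%:E)%E.
    have DF : (nu D <= \int[nu]_w (ncard [set w' | F (w, w')])%:R%:E)%E.
      rewrite -[D]setIT -(@integral_indic _ _ _ nu setT measurableT _ mD).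
      apply: le_integral_ge0 => w; first by rewrite lee_fin.
      rewrite lee_fin indicE; have [/set_mem/DP[s sS Fs]|_] := boolP (w \in D) => //.
      rewrite ler1n ncard_gt0//; last by exists (ext (act s) w).
      by apply: (@graphing_degree_finite _ S _ act) => p [].
    apply: le_lt_trans DF _; move: We; rewrite /edge_measure -/F.
    rewrite muleC -lte_pdivlMr//.
    by rewrite -EFinM (_ : e / 2 / (1 / 2) = e)%R//; field.
  have [nuD _] := nuR D mD.
  have : (ereal_inf [set nu U | U in [set U | openB U /\ D `<=` U]] < e%:E)%E.
    by rewrite -nuD.
  move=> /ereal_inf_lt[_ [U [Uo DU] <-] Ue].
  (* Outside [U] every graphing edge belongs to [W], so components lie inside those of [W]. *)
  have UK : components_le S (extact act) (~` U) K.
    move=> w Uw; apply: card_le_sub (WK w) => w' /=.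
    elim=> [a b [Ua [Ub [ab [s sS sab]]]]|a|a b c _ h1 _ h2].
    + apply: rt_step; apply: contrapT => Wab; apply: Ua; apply: DU; apply/DP.
      by exists s => //; rewrite sab; split=> //; split=> //; exists s.
    + exact: rt_refl.
    + exact: rt_trans h1 h2.
  have [|A [UA AK]] := components_le_closed actA _ UK; first by rewrite setCK.
  exists (~` A); split.
    rewrite -lte_fin muE; apply: le_lt_trans Ue.
    apply: le_measure; rewrite ?inE//; first exact: openB_measurable.
    by rewrite -setC_U -[U]setCK; exact: subsetC.
  exists K.+1; split=> //; rewrite setCK.
  exact: components_le_leq AK.
Qed.

(** * From hyperfinite means to measures *)

Lemma ncard1 (T : choiceType) (x : T) : ncard [set x] = 1%N.
Proof.
by apply: (@ncard_uniq _ _ [:: x]) => // y; rewrite inE; split=> [/eqP|->].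
Qed.

Lemma mean_hyperfinite_measure (R : realType) (G : groupType) (S : seq G)
    (X : pointedType) (act : G -> X -> X) (mu : set X -> R) :
  symmetric_gen_set S -> is_action act ->
  is_mean mu -> invariant_mean act mu -> mean_hyperfinite S act mu ->
  exists nu : probability (betaXm X) R,
    [/\ regular_measure nu, ext_invariant act nu & hyperfinite_wrt S act nu].
Proof.
move=> [Ssym _] actA muM muI mu3; have [nu [nuR nuE]] := mean_extension muM.
have mU A : measurable (U_ A : set (betaXm X)) by exact: openB_measurable (@openB_U _ A).
have nuI : ext_invariant act nu.
  by move=> g B mB; rewrite !nuE mean_outer_invariant.
have nuU A : nu (U_ A) = (mu A)%:E by rewrite nuE outer_U.
exists nu; split=> // e e0.
(* Each generator adds at most [2 * mu Y] to the integral of the missing degree, so the missing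
   edges weigh at most [size S] times [mu Y]; the successor keeps the divisor positive when [S] is
   empty. *)
have e'0 : (0 < e / (size S).+1%:R)%R by rewrite divr_gt0.
have [Y [Ye [K [K0 YK]]]] := mu3 _ e'0.
pose W : set (betaX2m X) := [set p | graphing_edges S act p /\
  U_ (~` Y) p.1 /\ U_ (~` Y) p.2].
have WE : W `<=` graphing_edges S act by move=> p [].
exists K, W; split=> //.
- rewrite measurable_BorelB2; apply: measurableI; first exact: measurable_graphing.
  apply: openB2_measurable => -[w w'] [wY wY'].
  by exists (~` Y), (~` Y); split=> //; split=> // -[].
- move=> a b [[/= ab [s sS sab]] [aY bY]]; split=> //; split=> /=; first exact/nesym.
  by exists (monoid.inv s); [exact: Ssym|rewrite -sab ext_actK].
- pose F := graphing_edges S act `\` W.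
  pose B s : set (betaXm X) := U_ Y `|` ext (act s) @^-1` (U_ Y).
  have mB s : measurable (B s).
    by apply: measurableU => //; rewrite ext_preimage_U.
  have nuB s : (nu (B s) <= (2 * mu Y)%:E)%E.
    apply: (@le_trans _ _ (nu (U_ Y) + nu (ext (act s) @^-1` (U_ Y)))%E).
      by apply: measureU2 => //; rewrite ext_preimage_U.
    by rewrite nuI// nuU -EFinD lee_fin mulr_natl mulr2n.
  have deg w : ((ncard [set w' | F (w, w')])%:R%:E <=
      \sum_(s <- S) (\1_(B s) w : R)%:E)%E.
    pose A s := [set w' | B s w /\ w' = ext (act s) w].
    have A1 s : finite_set (A s).
      by apply: sub_finite_set (finite_set1 (ext (act s) w)) => w' [].
    rewrite sumEFin lee_fin.
    apply: (@le_trans _ _ (\sum_(s <- S) ncard (A s))%:R%R).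
      rewrite ler_nat; apply: leq_trans (ncard_bigcup_le _) => //.
      apply: ncard_le; first by apply: bigcup_finite; [exact: finite_seq|move=> s _; exact: A1].
      move=> w' [[/= ww' [s sS sw]] nW]; exists s => //; split=> //.
      apply: contrapT => /not_orP[/ufsets_setC wY wY']; apply: nW.
      split; first by split=> //; exists s.
      by split=> //; apply/ufsets_setC; rewrite -sw.
    rewrite natr_sum; apply: ler_sum => s _; rewrite indicE.
    have [/set_mem sB|nB] := boolP (w \in B s).
      rewrite ler_nat; apply: (@leq_trans (ncard [set ext (act s) w])).
        by apply: ncard_le => // w' [].
      by rewrite ncard1.
    rewrite (_ : A s = set0) ?ncard0//; apply/seteqP; split=> // w' [sB _].
    by move/negP: nB; apply; exact/mem_set.
  have intE : (\int[nu]_w (\sum_(s <- S) (\1_(B s) w : R)%:E) =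
      \sum_(s <- S) nu (B s))%E.
    rewrite ge0_integral_sum//.
      by apply: eq_bigr => s _; rewrite integral_indic// setIT.
    by move=> s; apply/measurable_EFinP; exact: measurable_indic.
  have intle : (\int[nu]_w (ncard [set w' | F (w, w')])%:R%:E <=
      ((size S)%:R * (2 * mu Y))%:E)%E.
    have F0 w : (0 <= (ncard [set w' | F (w, w')])%:R%:E :> \bar R)%E.
      by rewrite lee_fin.
    apply: le_trans (le_integral_ge0 nu F0 deg) _.
    rewrite intE; apply: le_trans (lee_sum _ (fun s _ => nuB s)) _.
    by rewrite sumEFin lee_fin big_const_seq count_predT iter_addr_0 [leRHS]mulr_natl.
  rewrite /edge_measure -/F.
  apply: (@le_lt_trans _ _ ((1 / 2)%:E * ((size S)%:R * (2 * mu Y))%:E)%E).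
    by apply: lee_wpmul2l intle; rewrite lee_fin divr_ge0.
  rewrite -EFinM lte_fin.
  have -> : (1 / 2 * ((size S)%:R * (2 * mu Y)) = (size S)%:R * mu Y :> R)%R.
    by field.
  apply: (@le_lt_trans _ _ ((size S).+1%:R * mu Y)%R).
    by rewrite ler_wpM2r ?mean_ge0// ler_nat.
  by rewrite mulrC -ltr_pdivlMr.
- move=> w; have [wY|wY] := pselect (U_ (~` Y) w).
    apply: card_le_sub (components_le_clopen actA YK wY) => w' /=.
    elim=> [a b [[ab sab] [aY bY]]|a|a b c _ h1 _ h2].
    + exact: rt_step.
    + exact: rt_refl.
    + exact: rt_trans h1 h2.
  (* No edge of [W] starts at a point of [U_ Y], so the component is a single point, within the
     bound as [K] is positive. *)
  exists [:: w]; split=> // w' /= ww'; left.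
  elim: ww' wY => [a b [_ [aY _]] /(_ aY)|//|a b c _ h1 _ h2 aY] //.
  by rewrite (h1 aY); apply: h2; rewrite -(h1 aY).
Qed.

(** * From means to Folner sequences *)

(** Monotonicity of the integral of a simple function against a finitely additive mean. The
    induction splits [B] along the first set and moves its coefficient into the constant [c] on the
    part inside. *)
Lemma mean_linear_ge (R : realType) (X : Type) (mu : set X -> R)
    (L : seq (R * set X)) (B : set X) (c : R) : is_mean mu ->
  (forall x, B x -> c <= \sum_(p <- L) p.1 * (x \in p.2)%:R)%R ->
  (c * mu B <= \sum_(p <- L) p.1 * mu (p.2 `&` B))%R.
Proof.
move=> muM; elim: L B c => [|[c1 A] L IH] B c BL.
  rewrite big_nil; have [->|/set0P[x Bx]] := eqVneq B set0.
    by rewrite mean0// mulr0.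
  by have := BL x Bx; rewrite big_nil => c0; rewrite mulr_le0_ge0// mean_ge0.
have h1 : ((c - c1) * mu (B `&` A) <= \sum_(p <- L) p.1 * mu (p.2 `&` (B `&` A)))%R.
  apply: IH => x [/BL + Ax]; rewrite big_cons/= mem_set// mulr1.
  by rewrite lerBlDl.
have h2 : (c * mu (B `&` ~` A) <=
    \sum_(p <- L) p.1 * mu (p.2 `&` (B `&` ~` A)))%R.
  by apply: IH => x [/BL + Ax]; rewrite big_cons/= memNset// mulr0 add0r.
rewrite big_cons/= (meanID muM B A) (setIC A B).
have -> : (\sum_(p <- L) p.1 * mu (p.2 `&` B) =
    \sum_(p <- L) p.1 * mu (p.2 `&` (B `&` A)) +
    \sum_(p <- L) p.1 * mu (p.2 `&` (B `&` ~` A)))%R.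
  rewrite -big_split/=; apply: eq_bigr => p _.
  by rewrite (meanID muM (p.2 `&` B) A) mulrDr !setIA.
lra.
Qed.

Lemma mean_partition (R : realType) (X : Type) (mu : set X -> R) (f : X -> nat)
    (N : nat) (A : set X) : is_mean mu -> (forall x, A x -> (f x < N)%N) ->
  mu A = (\sum_(i <- iota 0 N) mu (A `&` [set x | f x = i]))%R.
Proof.
move=> muM; elim: N A => [|N IH] A fN.
  rewrite big_nil (_ : A = set0) ?mean0//.
  by apply/seteqP; split=> // x /fN.
rewrite (meanID muM A [set x | f x = N]) -addn1 iotaD big_cat/= big_seq1 addrC.
congr (_ + _)%R; rewrite IH => [|x [/fN + fx]]; last first.
  by rewrite ltnS leq_eqVlt => /predU1P[/fx|].
apply: eq_big_seq => i; rewrite mem_iota => /andP[_ iN].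
congr mu; apply/seteqP; split=> x [Ax fx]; first by case: Ax.
split=> //; split=> //= fxN; move: iN; rewrite add0n -fxN.
by rewrite [f x]fx ltnn.
Qed.

Lemma mean_preimage (R : realType) (G : groupType) (X : Type)
    (act : G -> X -> X) (mu : set X -> R) g A : is_action act ->
  invariant_mean act mu -> mu (act g @^-1` A) = mu A.
Proof. by move=> actA muI; rewrite act_preimageE// muI. Qed.

(** * A canonical point of each component *)

Section leaders.
Context (G : groupType) (S : seq G) (X : pointedType) (act : G -> X -> X).
Hypotheses (Ssym : symmetric_gen_set S) (actA : is_action act).
Variable V : set X.
Local Notation conn := (induced_conn S act V).
Local Notation comp x := [set y | conn x y].

Lemma induced_conn_sym x y : conn x y -> conn y x.
Proof.
elim=> [a b [Va [Vb [ab [s sS sab]]]]|a|a b c _ h1 _ h2].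
- apply: rt_step; split=> //; split=> //; split; first exact/nesym.
  by exists (monoid.inv s); [exact: Ssym.1|rewrite -sab actK].
- exact: rt_refl.
- exact: rt_trans h2 h1.
Qed.

(** [get] depends on the set alone, so all points of a component have the same leader; it is the
    point to which mass is transported. *)
Definition leader (x : X) : X := get (comp x).

Lemma leader_conn x : conn x (leader x).
Proof. by apply: (@getPex _ (comp x)); exists x; exact: rt_refl. Qed.

Lemma leader_eq x y : conn x y -> leader x = leader y.
Proof.
move=> xy; congr get; apply/seteqP; split=> z /= h; last exact: rt_trans xy h.
exact: rt_trans (induced_conn_sym xy) h.
Qed.

End leaders.

(* A component [C] with leader [x] is the set of the points [t_i x], where [t_i]
   ranges over finitely many group elements. Moving the part of [V] reached by
   [t_i] onto the leaders turns a sum of means over [V] into the mean, over the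
   leaders, of the sums over their components. *)
Lemma mass_transport (R : realType) (G : groupType) (S : seq G)
    (X : pointedType) (act : G -> X -> X) (mu : set X -> R) (V : set X) (K : nat)
    (L : seq (R * set X)) :
  symmetric_gen_set S -> is_action act -> is_mean mu -> invariant_mean act mu ->
  components_le S act V K ->
  (forall x, V x -> 0 <= \sum_(p <- L) p.1 *
     (ncard (p.2 `&` [set y | induced_conn S act V x y]))%:R)%R ->
  (0 <= \sum_(p <- L) p.1 * mu (p.2 `&` V))%R.
Proof.
move=> Ssym actA muM muI VK VL.
pose lead := leader S act V.
pose T := [seq foldr (@monoid.mul G) (@monoid.one G) w | w <- words S K].
pose N := size T; pose t i := nth (@monoid.one G) T i.
(* Several elements of [T] may carry the leader to [y]; taking the first index counts every point
   once. *)
pose rank_ y := find (fun g => act g (lead y) == y) T.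
have V_lead y : V y -> V (lead y).
  by move=> Vy; exact: induced_conn_in Vy (leader_conn _ _ _ _).
have hasT y : V y -> has (fun g => act g (lead y) == y) T.
  move=> Vy; have ly := induced_conn_sym Ssym actA (leader_conn S act V y).
  have [w wK wy] := components_le_words VK (V_lead _ Vy) ly.
  apply/hasP; exists (foldr (@monoid.mul G) (@monoid.one G) w).
    exact: map_f.
  by rewrite -walkE//; exact/eqP.
have iotaN y : V y -> (rank_ y < N)%N by move=> Vy; rewrite -has_find hasT.
have iotaE y : V y -> act (t (rank_ y)) (lead y) = y.
  by move=> Vy; exact/eqP/(nth_find _ (hasT _ Vy)).
pose P (A : set X) x i := [/\ A (act (t i) x), V (act (t i) x) &
  rank_ (act (t i) x) = i].
have leadP A x i : P A x i -> lead (act (t i) x) = x.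
  move=> [_ Vy iy]; have := iotaE _ Vy; rewrite iy.
  exact: (can_inj (actK _ actA)).
have count_lead A x : V x -> lead x = x ->
    count (fun i => `[< P A x i >]) (iota 0 N) =
    ncard (A `&` [set y | induced_conn S act V x y]).
  move=> Vx xx; pose l := [seq act (t i) x | i <- iota 0 N & `[< P A x i >]].
  rewrite -size_filter -(size_map (fun i => act (t i) x)); apply/esym/ncard_uniq.
    rewrite map_inj_in_uniq ?filter_uniq ?iota_uniq// => i j.
    rewrite !mem_filter => /andP[/asboolP[_ _ ei] _] /andP[/asboolP[_ _ ej] _] eij.
    by rewrite -ei -ej eij.
  move=> y; split=> [/mapP[i]|[Ay xy]].
    rewrite mem_filter => /andP[/asboolP Pi _] ->; have [Ay Vy iy] := Pi.
    split=> //=; apply: (induced_conn_sym Ssym actA).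
    by rewrite -[X in induced_conn _ _ _ _ X](leadP A x i Pi); exact: leader_conn.
  have Vy := induced_conn_in Vx xy.
  have yx : lead y = x by rewrite -xx; apply/esym/leader_eq.
  have yE := iotaE _ Vy; rewrite yx in yE.
  apply/mapP; exists (rank_ y) => //; rewrite mem_filter mem_iota/= iotaN// andbT.
  by apply/asboolP; rewrite /P yE.
have count_nlead A x : ~ (V x /\ lead x = x) ->
    count (fun i => `[< P A x i >]) (iota 0 N) = 0%N.
  move=> nx; rewrite (eq_count (a2 := pred0)) ?count_pred0// => i.
  apply/asboolP => Pi; apply: nx; have ly := leadP _ _ _ Pi.
  have [_ Vy _] := Pi; move: (act (t i) x) ly Vy => y <- Vy.
  split; first exact: V_lead.
  by apply/esym/leader_eq => //; exact: leader_conn.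
(* Each set is cut by rank, and the piece of rank [i] is pulled back by [t i] to the leaders;
   invariance preserves its mean. *)
pose L' := [seq (p.1, act (t i) @^-1` (p.2 `&` V `&` [set y | rank_ y = i]))
  | p <- L, i <- iota 0 N].
have -> : (\sum_(p <- L) p.1 * mu (p.2 `&` V) =
    \sum_(q <- L') q.1 * mu (q.2 `&` setT))%R.
  rewrite big_allpairs_dep; apply: eq_bigr => p _ /=.
  rewrite (@mean_partition _ _ mu rank_ N (p.2 `&` V)) => //; last first.
    by move=> x [_ /iotaN].
  by rewrite mulr_sumr; apply: eq_bigr => i _; rewrite setIT mean_preimage.
have := @mean_linear_ge R X mu L' setT 0 muM; rewrite mul0r; apply=> x _.
have -> : (\sum_(q <- L') q.1 * (x \in q.2)%:R =
    \sum_(p <- L) p.1 * (count (fun i => `[< P p.2 x i >]) (iota 0 N))%:R :> R)%R.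
  rewrite big_allpairs_dep; apply: eq_bigr => p _ /=.
  rewrite -mulr_sumr -sum1_count [in RHS]big_mkcond natr_sum; congr (_ * _)%R.
  apply: eq_bigr => i _; congr (_%:R)%R.
  have [Pi|nPi] := asboolP (P p.2 x i).
    by rewrite mem_set//; have [? ? ?] := Pi.
  by rewrite memNset// => -[[? ?] ?]; apply: nPi.
(* At a leader in [V] the simple function is the sum over its component, nonnegative by hypothesis;
   elsewhere it vanishes. *)
have [[Vx xx]|nx] := pselect (V x /\ lead x = x).
  rewrite (eq_bigr (fun p => p.1 *
     (ncard (p.2 `&` [set y | induced_conn S act V x y]))%:R)%R); first exact: VL.
  by move=> p _; rewrite count_lead.
by rewrite big1// => p _; rewrite count_nlead// mulr0.
Qed.

(** The weights in [L] make the combination of means negative, so by [mass_transport] some component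
    has a negative count: [n.+1] times its exits plus the sum of [j.+1] times its points in [Y j]
    stays below its size. Both bounds follow. *)
Lemma folner_set_of_mean (R : realType) (G : groupType) (S : seq G)
    (X : pointedType) (act : G -> X -> X) (mu : set X -> R) (Y : nat -> set X)
    (n : nat) :
  symmetric_gen_set S -> is_action act -> is_mean mu -> invariant_mean act mu ->
  mean_hyperfinite S act mu ->
  (forall j, mu (Y j) < (2 ^ j.+2)%:R^-1 / j.+1%:R)%R ->
  exists F : set X, [/\ finite_set F, F !=set0,
    (isoperimetric R S act F < n.+1%:R^-1)%R &
    forall j, (j < n)%N -> (j.+1 * ncard (F `&` Y j) < ncard F)%N].
Proof.
move=> Ssym actA muM muI mu3 muY.
(* The summand 1 pays for [mu V] being [1 - mu Z] and the rest for the exits; together they cost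
   less than 1/2, while the sets [Y j] cost at most 1/2. *)
pose e : R := (2 * (n.+1 * size S).+1%:R)^-1%R.
have e0 : (0 < e)%R by rewrite invr_gt0 mulr_gt0.
have [Z [Ze [K [K0 ZK]]]] := mu3 e e0.
pose V := ~` Z; pose C x := [set y | induced_conn S act V x y].
pose E s := [set x | V x /\ ~ V (act s x)].
pose L : seq (R * set X) := (-1, setT)%R :: [seq (n.+1%:R, E s)%R | s <- S] ++
  [seq (j.+1%:R, Y j)%R | j <- iota 0 n].
have LE (f : set X -> R) : (\sum_(p <- L) p.1 * f p.2 = - f setT +
    n.+1%:R * \sum_(s <- S) f (E s) + \sum_(j <- iota 0 n) j.+1%:R * f (Y j))%R.
  by rewrite big_cons big_cat/= !big_map/= mulN1r -mulr_sumr addrA.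
have [x [Vx Lx]] : exists x, V x /\
    (\sum_(p <- L) p.1 * (ncard (p.2 `&` C x))%:R < 0)%R.
  apply: contrapT => nx.
  have : (0 <= \sum_(p <- L) p.1 * mu (p.2 `&` V))%R.
    apply: mass_transport ZK _ => // x Vx; rewrite leNgt; apply/negP => Lx.
    by apply: nx; exists x.
  rewrite (LE (fun A => mu (A `&` V))) setTI.
  have hV : mu V = (1 - mu Z)%R by rewrite /V meanC.
  have hE : (\sum_(s <- S) mu (E s `&` V) <= (size S)%:R * mu Z)%R.
    have -> : ((size S)%:R * mu Z = \sum_(s <- S) mu Z)%R.
      by rewrite big_const_seq count_predT iter_addr_0 mulr_natl.
    apply: ler_sum => s _; rewrite -(mean_preimage s Z actA muI).
    by apply: mean_mono => // y [[_ /contrapT]].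
  have hY : (\sum_(j <- iota 0 n) j.+1%:R * mu (Y j `&` V) <= 1 / 2)%R.
    apply: (@le_trans _ _ (\sum_(j <- iota 0 n) (2 ^ j.+2)%:R^-1)%R).
      apply: ler_sum => j _; rewrite mulrC -ler_pdivlMr//.
      by apply: le_trans (ltW (muY j)); apply: mean_mono => // y [].
    suff -> : (\sum_(j <- iota 0 n) (2 ^ j.+2)%:R^-1 = 1 / 2 - (2 ^ n.+1)%:R^-1 :> R)%R.
      by rewrite lerBlDr lerDl invr_ge0.
    elim: (n) => [|m IH]; first by rewrite big_nil expn1 div1r subrr.
    rewrite -addn1 iotaD big_cat IH/= big_seq1 add0n addn1.
    have : ((2 ^ m.+1)%:R != 0 :> R)%R by rewrite pnatr_eq0 expn_eq0.
    rewrite (expnS 2 m.+1) natrM => h; field; exact: h.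
  have hZ : ((n.+1 * size S).+1%:R * mu Z < 1 / 2)%R.
    rewrite mulrC -ltr_pdivlMr//; apply: lt_le_trans Ze _.
    by rewrite /e invfM div1r.
  have hE' : (n.+1%:R * \sum_(s <- S) mu (E s `&` V) <=
      (n.+1 * size S)%:R * mu Z)%R.
    by rewrite natrM -mulrA ler_pM2l.
  rewrite -natr1 mulrDl mul1r in hZ; move: hV hE' hY hZ; lra.
have Cfin : finite_set (C x) by exact: card_le_finite (ZK _ Vx).
have finI A : finite_set (A `&` C x) by apply: sub_finite_set Cfin => y [].
have Cne : C x !=set0 by exists x; exact: rt_refl.
move: Lx; rewrite (LE (fun A => (ncard (A `&` C x))%:R%R)) setTI => Lx.
have hE0 : (0 <= \sum_(s <- S) (ncard (E s `&` C x))%:R :> R)%R by apply: sumr_ge0.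
have hY0 : (0 <= \sum_(j <- iota 0 n) j.+1%:R * (ncard (Y j `&` C x))%:R :> R)%R.
  by apply: sumr_ge0 => j _; rewrite mulr_ge0.
exists (C x); split=> //.
  rewrite /isoperimetric ltr_pdivrMr ?ltr0n ?ncard_gt0// -ltr_pdivrMl ?invr_gt0//.
  rewrite invrK; apply: (@le_lt_trans _ _
      (n.+1%:R * \sum_(s <- S) (ncard (E s `&` C x))%:R)%R).
    rewrite ler_pM2l// -natr_sum ler_nat.
    (* A boundary edge of a component of [V] must leave [V], so it is one of the exits counted by
       [E s]. *)
    pose D s := (fun y => (y, act s y)) @` (E s `&` C x).
    have finD s : finite_set (D s) by exact: finite_image.
    apply: (@leq_trans (ncard (\bigcup_(s in [set` S]) D s))).
      apply: ncard_le; first by apply: bigcup_finite; [exact: finite_seq|].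
      move=> [y z] [/= xy [nxz [yz [s sS sy]]]]; exists s => //; exists y.
        split=> //; have Vy := induced_conn_in Vx xy; split=> // Vz.
        apply: nxz; apply: rt_trans xy _; apply: rt_step; split=> //.
        by rewrite -sy; split=> //; split=> //; rewrite ?sy//; exists s.
      by rewrite sy.
    apply: leq_trans (ncard_bigcup_le _) _ => //.
    by apply: leq_sum => s _; exact: ncard_image_le.
  move: Lx hY0; lra.
move=> j jn; rewrite -(ltr_nat R) natrM setIC.
have : (j.+1%:R * (ncard (Y j `&` C x))%:R <=
    \sum_(j <- iota 0 n) j.+1%:R * (ncard (Y j `&` C x))%:R :> R)%R.
  rewrite (bigD1_seq j) ?mem_iota ?iota_uniq//= lerDl.
  by apply: sumr_ge0 => i _; rewrite mulr_ge0.
have : (0 <= n.+1%:R * \sum_(s <- S) (ncard (E s `&` C x))%:R :> R)%R.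
  by rewrite mulr_ge0.
move: Lx; lra.
Qed.

(** A diagonal choice: [F n] is tested against [Y j] only for [j] below [n], so for a fixed
    tolerance one [Y j] serves all but finitely many [n], and the sizes of the remaining [F n] are
    absorbed into the component bound. *)
Lemma mean_folner (R : realType) (G : groupType) (S : seq G)
    (X : pointedType) (act : G -> X -> X) (mu : set X -> R) :
  symmetric_gen_set S -> is_action act -> is_mean mu -> invariant_mean act mu ->
  mean_hyperfinite S act mu ->
  exists F : nat -> set X, folner_seq R S act F /\ hyperfinite_seq R S act F.
Proof.
move=> Ssym actA muM muI mu3.
have d0 j : (0 < (2 ^ j.+2)%:R^-1 / j.+1%:R :> R)%R.
  by rewrite divr_gt0// invr_gt0 ltr0n expn_gt0.
have [Y hY] := choice (fun j => mu3 _ (d0 j)).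
have [F hF] := choice (fun n => folner_set_of_mean n Ssym actA muM muI mu3
  (fun j => (hY j).1)).
have Ff n : finite_set (F n) by have [] := hF n.
exists F; split.
  split=> [n|]; first by have [] := hF n.
  apply: (@squeeze_cvgr _ _ _ _ (fun=> 0%R) (fun n => n.+1%:R^-1%R)).
  - apply: nearW => n; have [_ _ /ltW -> _] := hF n; rewrite andbT.
    by rewrite divr_ge0.
  - exact: cvg_cst.
  - exact: cvg_harmonic.
move=> e e0; pose j := Num.truncn (e^-1)%R.
have je : (j.+1%:R^-1 < e)%R.
  by rewrite invf_plt ?posrE// truncnS_gt.
have [_ [K [K0 YK]]] := hY j.
exists (K + \sum_(n < j.+1) ncard (F n))%N; split; first by rewrite addn_gt0 K0.
exists (fun n => if (j < n)%N then F n `&` Y j else set0) => n.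
have [_ Fn0 _ Fj] := hF n.
have Fgt0 : (0 < (ncard (F n))%:R :> R)%R by rewrite ltr0n ncard_gt0.
case: ltnP => jn; split.
- by move=> x [].
- split.
    have := Fj j jn; rewrite -(ltr_nat R) natrM => h.
    apply: (@lt_le_trans _ _ (j.+1%:R^-1 * (ncard (F n))%:R)%R).
      by rewrite -ltr_pdivrMl ?invr_gt0// invrK.
    by rewrite ler_pM2r// ltW.
  apply: (@components_le_leq _ _ _ _ _ K); first exact: leq_addr.
  by apply: components_le_sub YK => x [Fx nFY] Yx; apply: nFY.
- by [].
- rewrite ncard0; split; first by rewrite mulr_gt0.
  rewrite setD0; apply: components_le_leq (components_le_finite _ _ (Ff n)).
  have jn' : (n < j.+1)%N by [].
  by rewrite (bigD1 (Ordinal jn'))//= addnCA leq_addr.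
Qed.

(** * From Folner sequences to means *)

Local Notation boundary S act F :=
  [set p | F p.1 /\ ~ F p.2 /\ schreier_adj S act p.1 p.2].

Lemma finite_boundary (G : groupType) (S : seq G) (X : pointedType)
    (act : G -> X -> X) (F : set X) :
  finite_set F -> finite_set (boundary S act F).
Proof.
move=> Ff; pose D s := (fun x => (x, act s x)) @` F.
apply: (@sub_finite_set _ _ (\bigcup_(s in [set` S]) D s)); last first.
  by apply: bigcup_finite; [exact: finite_seq|move=> s _; exact: finite_image].
by move=> [x y] [/= Fx [_ [_ [s sS <-]]]]; exists s => //; exists x.
Qed.

Definition freq (R : realType) (X : pointedType) (F A : set X) : R :=
  ((ncard (A `&` F))%:R / (ncard F)%:R)%R.

Lemma freq_mean (R : realType) (X : pointedType) (F : set X) :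
  finite_set F -> F !=set0 -> is_mean (freq R F).
Proof.
move=> Ff F0; have Fgt0 : (0 < (ncard F)%:R :> R)%R by rewrite ltr0n ncard_gt0.
have fI A : finite_set (A `&` F) by apply: sub_finite_set Ff => x [].
split=> [A|].
  rewrite divr_ge0//= ler_pdivrMr// mul1r ler_nat.
  by apply: ncard_le => // x [].
split=> [|A B AB]; first by rewrite /freq setTI divff// gt_eqF.
rewrite /freq setIUl ncardU// ?natrD ?mulrDl//.
by rewrite setIACA AB set0I.
Qed.

(* A point [s x] of [F] with [x] outside [F] is an endpoint of a boundary edge. *)
Lemma freq_image_le (R : realType) (G : groupType) (S : seq G)
    (X : pointedType) (act : G -> X -> X) (F A : set X) s :
  symmetric_gen_set S -> is_action act -> finite_set F -> s \in S ->
  (freq R F (act s @` A) <= freq R F A + isoperimetric R S act F)%R.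
Proof.
move=> Ssym actA Ff sS.
rewrite /freq /isoperimetric -mulrDl ler_wpM2r ?invr_ge0// -natrD ler_nat.
have fI : finite_set (A `&` F) by apply: sub_finite_set Ff => x [].
have fB := finite_boundary S act Ff.
apply: (@leq_trans (ncard (act s @` (A `&` F) `|` fst @` boundary S act F))).
  apply: ncard_le; first by rewrite finite_setU; split; exact: finite_image.
  move=> _ [[x Ax <-] Fsx]; have [Fx|nFx] := pselect (F x); first by left; exists x.
  right; exists (act s x, x) => //=; split=> //; split=> //.
  split; first by move=> xx; apply: nFx; rewrite -xx.
  by exists (monoid.inv s); [exact: Ssym.1|rewrite actK].
apply: leq_trans (ncardU_le _ _) _; try exact: finite_image.
by apply: leq_add; exact: ncard_image_le.
Qed.

(** The inequality for the inverse generator gives equality, and words in the generators give the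
    whole group. *)
Lemma invariant_mean_gen (R : realType) (G : groupType) (S : seq G)
    (X : Type) (act : G -> X -> X) (mu : set X -> R) :
  symmetric_gen_set S -> is_action act ->
  (forall s A, s \in S -> (mu (act s @` A) <= mu A)%R) ->
  invariant_mean act mu.
Proof.
move=> [Ssym Sgen] actA mule g A; have [act1 actM] := actA.
have muS s B : s \in S -> mu (act s @` B) = mu B.
  move=> sS; apply/eqP; rewrite eq_le mule//=.
  have := mule (monoid.inv s) (act s @` B) (Ssym _ sS).
  congr (_ <= _)%R; congr mu; rewrite image_comp.
  by rewrite (_ : _ \o _ = id) ?image_id//; apply/funext => x /=; rewrite actK.
have [w [wS ->]] := Sgen g.
elim: w wS => [_|s w IH /= /andP[sS wS]] /=.
  have -> : act (@monoid.one G) = id by apply/funext.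
  by rewrite image_id.
rewrite -IH// -[RHS](muS s)//; congr mu; rewrite image_comp.
by apply: (congr1 (image A)); apply/funext => x /=; rewrite actM.
Qed.

(** Compactness of the unit interval gives a cluster point, and an ultrafilter converges to each of
    its cluster points. *)
Lemma ultrafilter_cvg (R : realType) (U : set_system nat) (u : nat -> R) :
  UltraFilter U -> (forall n, 0 <= u n <= 1)%R -> exists l : R, u @ U --> l.
Proof.
move=> UU u01; have FF : ProperFilter (u @ U) by exact: fmap_proper_filter.
have [|l [_ lU]] := @segment_compact R 0%R 1%R (u @ U) FF.
  by rewrite /fmap/=; apply: filterE => n; rewrite /= in_itv/=; exact: u01.
exists l => V lV; have [//|UV] := in_ultra_setVsetC (u @^-1` V) UU.
by have [x [nVx Vx]] := lU (~` V) V UV lV.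
Qed.

Lemma ultralimit_mean (R : realType) (X : pointedType) (P : nat -> set X)
    (U : set_system nat) (mu : set X -> R) : UltraFilter U ->
  (forall n, finite_set (P n) /\ P n !=set0) ->
  (forall A, (fun n => freq R (P n) A) @ U --> mu A) -> is_mean mu.
Proof.
move=> UU Pf mul; have UF : ProperFilter U by exact: ultra_proper.
have Pm n : is_mean (freq R (P n)) by have [? ?] := Pf n; exact: freq_mean.
split=> [A|].
  apply/andP; split.
    apply: (ler_cvg_to (cvg_cst _) (mul A)); apply: filterE => n.
    exact: mean_ge0.
  apply: (ler_cvg_to (mul A) (cvg_cst _)); apply: filterE => n.
  exact: mean_le1.
split=> [|A B AB].
  apply: (cvg_unique (@Rhausdorff R) (mul setT)).
  rewrite (_ : (fun _ => _) = cst 1%R); first exact: cvg_cst.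
  by apply/funext => n; exact: meanT.
apply: (cvg_unique (@Rhausdorff R) (mul (A `|` B))).
rewrite (_ : (fun _ => _) = (fun n => freq R (P n) A + freq R (P n) B)%R).
  exact: cvgD.
by apply/funext => n; exact: meanU.
Qed.

(** Without boundary the error term in [freq_image_le] is 0, so the uniform mean on [F] is
    invariant; removing the null complement of [F] leaves a finite set. *)
Lemma folner_finite_orbit (R : realType) (G : groupType) (S : seq G)
    (X : pointedType) (act : G -> X -> X) (F : set X) :
  symmetric_gen_set S -> is_action act -> finite_set F -> F !=set0 ->
  boundary S act F = set0 ->
  exists mu : set X -> R,
    [/\ is_mean mu, invariant_mean act mu & mean_hyperfinite S act mu].
Proof.
move=> Ssym actA Ff F0 B0; exists (freq R F); split; first exact: freq_mean.
  apply: (invariant_mean_gen Ssym actA) => s A sS.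
  apply: le_trans (freq_image_le _ _ Ssym actA Ff sS) _.
  by rewrite /isoperimetric B0 ncard0 mul0r addr0.
move=> e e0; exists (~` F); split; first by rewrite /freq setICl ncard0 mul0r.
exists (ncard F); split; first exact: ncard_gt0.
rewrite setCK; exact: components_le_finite.
Qed.

(** A nonempty boundary makes the isoperimetric ratio at least the inverse of the size of [F n], so
    a small ratio forces [F n] to be large. *)
Lemma large_folner_set (R : realType) (G : groupType) (S : seq G)
    (X : pointedType) (act : G -> X -> X) (F : nat -> set X) :
  folner_seq R S act F -> (forall n, boundary S act (F n) <> set0) ->
  forall (e : R) (M : nat), (0 < e)%R -> exists n,
    (M <= ncard (F n))%N /\ (isoperimetric R S act (F n) < e)%R.
Proof.
move=> [Ff Fl] Fb e M e0.
have m0 : (0 < Num.min e M.+1%:R^-1)%R by rewrite lt_min e0 invr_gt0 ltr0n.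
have /cvgrPdist_lt/(_ _ m0)[n _ /(_ n (leqnn n))] := Fl.
rewrite sub0r normrN => /(le_lt_trans (ler_norm _)); rewrite lt_min => /andP[Fe FM].
exists n; split=> //; have [fF F0] := Ff n.
have Fgt0 : (0 < (ncard (F n))%:R :> R)%R by rewrite ltr0n ncard_gt0.
have : ((ncard (F n))%:R^-1 < M.+1%:R^-1 :> R)%R.
  apply: le_lt_trans FM; rewrite /isoperimetric ler_pdivlMr// mulVf ?gt_eqF//.
  rewrite ler1n ncard_gt0//; first exact: finite_boundary.
  by apply/set0P/eqP; exact: Fb.
rewrite ltf_pV2 ?posrE// ltr_nat => /ltnW; exact: leq_trans.
Qed.

(* Replacing [P k] by [P k] minus the union [Z k] of the previous sets makes the
   sequence disjoint at a small cost, because [Z k] is small compared to [P k]. *)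
Lemma folner_disjoint_mean (R : realType) (G : groupType) (S : seq G)
    (X : pointedType) (act : G -> X -> X) (P Z : nat -> set X) :
  symmetric_gen_set S -> is_action act ->
  (forall k, finite_set (P k) /\ P k !=set0) ->
  (forall k, finite_set (Z k)) -> (forall j k, (j < k)%N -> P j `<=` Z k) ->
  (forall k, k.+1 * ncard (Z k) <= ncard (P k))%N ->
  (forall k, isoperimetric R S act (P k) < k.+1%:R^-1)%R ->
  hyperfinite_seq R S act P ->
  exists mu : set X -> R,
    [/\ is_mean mu, invariant_mean act mu & mean_hyperfinite S act mu].
Proof.
move=> Ssym actA Pf Zf PZ Zs Piso Phyp.
(* [U] refines the filter of eventual properties, so ordinary limits are limits along [U]. *)
have [U [UU FU]] := ultraFilterLemma eventually_filter.
have UF : ProperFilter U by exact: ultra_proper.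
have cvgU (u : nat -> R) (l : R) : u @ \oo --> l -> u @ U --> l.
  by move=> ul V /ul; exact: FU.
have harmU : (fun n => n.+1%:R^-1 : R)%R @ U --> (0 : R)%R.
  by apply: cvgU; exact: cvg_harmonic.
have Pm k : is_mean (freq R (P k)) by have [? ?] := Pf k; exact: freq_mean.
have [|mu mul] := choice (_ : forall A, exists l : R,
    (fun n => freq R (P n) A) @ U --> l).
  move=> A; apply: ultrafilter_cvg => // n; exact: (Pm n).1.
exists mu; split; first exact: ultralimit_mean mul.
  apply: (invariant_mean_gen Ssym actA) => s A sS.
  rewrite -[leRHS]addr0; apply: (ler_cvg_to (mul _) (cvgD (mul A) harmU)).
  apply: filterE => k; have [Pfk _] := Pf k.
  apply: le_trans (freq_image_le _ _ Ssym actA Pfk sS) _.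
  by rewrite lerD2l ltW.
move=> e e0; have e20 : (0 < e / 2)%R by rewrite divr_gt0.
have [K [K0 [Y hY]]] := Phyp _ e20.
pose D k := P k `\` Z k.
have Ddisj j k x : D j x -> D k x -> j = k.
  move=> [Pj nZj] [Pk nZk]; case: (ltngtP j k) => // jk; exfalso.
    by apply: nZk; exact: PZ jk _ Pj.
  by apply: nZj; exact: PZ jk _ Pk.
(* All neighbours of a point of [V k] lie in [D k]; as the sets [D k] are disjoint, no edge joins
   [V j] to [V k] for distinct indices. *)
pose V k := [set x | [/\ D k x, ~ Y k x & forall s, s \in S -> D k (act s x)]].
exists (~` \bigcup_k V k); split; last first.
  exists K; split=> //; rewrite setCK => x [k _ Vx].
  have [[Pkx _] nYx _] := Vx.
  have [_ [_ PK]] := hY k.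
  apply: card_le_sub (PK x (conj Pkx nYx)) => y /= xy.
  suff [] : V k y /\ induced_conn S act (P k `\` Y k) x y by [].
  have {xy} := Operators_Properties.clos_rt_rtn1 _ _ _ _ xy.
  elim=> [|a b [_ [[j _ Vb] [ab [s sS sab]]]] _ [Va xa]].
    by split=> //; exact: rt_refl.
  have [[Pa _] nYa aD] := Va; have := aD s sS; rewrite sab => Db.
  have jk : j = k by apply: (Ddisj _ _ b) => //; have [] := Vb.
  subst j; split=> //; apply: rt_trans xa _; apply: rt_step.
  have [[Pb _] nYb _] := Vb.
  by split=> //; split=> //; split=> //; exists s.
apply: (@le_lt_trans _ _ (e / 2)%R); last by rewrite ltr_pdivrMr// ltr_pMr// ltr1n.
(* Of the [(size S).+2] small terms one is for [Z k], one for the boundary of [P k], and [size S]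
   for the translates of [Z k]; the remaining [e / 2] is for [Y k]. *)
have lim : (fun k => e / 2 + (size S).+2%:R * k.+1%:R^-1)%R @ U --> (e / 2)%R.
  rewrite -[X in _ --> X]addr0 -(mulr0 (size S).+2%:R%R).
  by apply: cvgD; [exact: cvg_cst|apply: cvgM => //; exact: cvg_cst].
apply: (ler_cvg_to (mul _) lim); apply: filterE => k.
have [Pfk P0k] := Pf k; have [YP [Yk _]] := hY k.
have Pgt0 : (0 < (ncard (P k))%:R :> R)%R by rewrite ltr0n ncard_gt0.
have Yfin : finite_set (Y k) by exact: sub_finite_set YP Pfk.
have Bfin := finite_boundary S act Pfk.
pose N s := act (monoid.inv s) @` Z k.
have Nfin s : finite_set (N s) by exact: finite_image.
have NSfin : finite_set (\bigcup_(s in [set` S]) N s).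
  by apply: bigcup_finite; [exact: finite_seq|move=> s _; exact: Nfin].
have nY : (ncard (~` (\bigcup_k V k) `&` P k) <= ncard (Z k) + ncard (Y k) +
    ncard (boundary S act (P k)) + size S * ncard (Z k))%N.
  apply: (@leq_trans (ncard (Z k `|` Y k `|` fst @` boundary S act (P k) `|`
      \bigcup_(s in [set` S]) N s))).
    apply: ncard_le.
      by rewrite !finite_setU; do !split => //; exact: finite_image.
    move=> x [nVx Px]; have [Zx|nZx] := pselect (Z k x); first by left; left; left.
    have [Yx|nYx] := pselect (Y k x); first by left; left; right.
    have /existsNP[s /not_implyP[sS nD]] : ~ forall s, s \in S -> D k (act s x).
      by move=> h; apply: nVx; exists k.
    have [Ps|nPs] := pselect (P k (act s x)).
      right; exists s => //; exists (act s x); last by rewrite actK.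
      by apply: contrapT => nZ; apply: nD.
    left; right; exists (x, act s x) => //=; split=> //; split=> //.
    by split; [move=> xs; apply: nPs; rewrite -xs|exists s].
  apply: leq_trans (ncardU_le _ _) _ => //.
    by rewrite !finite_setU; do !split => //; exact: finite_image.
  apply: leq_add.
    apply: leq_trans (ncardU_le _ _) _; rewrite ?finite_setU//.
      exact: finite_image.
    apply: leq_add; first by apply: ncardU_le.
    exact: ncard_image_le.
  apply: leq_trans (ncard_bigcup_le _) _ => //.
  rewrite -sum1_size big_distrl/=; apply: leq_sum => s _; rewrite mul1n.
  exact: ncard_image_le.
have hZ : ((ncard (Z k))%:R / (ncard (P k))%:R <= k.+1%:R^-1 :> R)%R.
  rewrite ler_pdivrMr// ler_pdivlMl// -natrM ler_nat.
  exact: Zs.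
have hY2 : ((ncard (Y k))%:R / (ncard (P k))%:R <= e / 2 :> R)%R.
  by rewrite ler_pdivrMr// ltW.
have hB := ltW (Piso k); rewrite /isoperimetric in hB.
rewrite /freq; move: nY; rewrite -(ler_nat R) => nY.
apply: (@le_trans _ _ (((ncard (Z k) + ncard (Y k) +
    ncard (boundary S act (P k)) + size S * ncard (Z k))%:R) / (ncard (P k))%:R)%R).
  by rewrite ler_pM2r// invr_gt0.
have -> : ((size S).+2%:R = (size S)%:R + 2 :> R)%R by rewrite -addn2 natrD.
rewrite !natrD !mulrDl natrM -mulrA.
have : ((size S)%:R * ((ncard (Z k))%:R / (ncard (P k))%:R) <=
    (size S)%:R * k.+1%:R^-1 :> R)%R by rewrite ler_wpM2l.
move: hZ hY2 hB; rewrite !div1r.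
move: (k.+1%:R^-1)%R ((ncard (Z k))%:R / _)%R ((ncard (Y k))%:R / _)%R => i z y.
move: (_ / (ncard (P k))%:R)%R (size S)%:R%R => b c; lra.
Qed.

Lemma folner_mean (R : realType) (G : groupType) (S : seq G)
    (X : pointedType) (act : G -> X -> X) (F : nat -> set X) :
  symmetric_gen_set S -> is_action act ->
  folner_seq R S act F -> hyperfinite_seq R S act F ->
  exists mu : set X -> R,
    [/\ is_mean mu, invariant_mean act mu & mean_hyperfinite S act mu].
Proof.
move=> Ssym actA Fol hyp; have [Ff _] := Fol.
have [[n Bn]|nB] := pselect (exists n, boundary S act (F n) = set0).
  by have [fF F0] := Ff n; exact: folner_finite_orbit Bn.
have {}nB n : boundary S act (F n) <> set0 by move=> Bn; apply: nB; exists n.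
(* The second coordinate will be the size of the union of the sets chosen so far. *)
have h (km : nat * nat) : exists n, (km.1.+1 * km.2 <= ncard (F n))%N /\
    (isoperimetric R S act (F n) < km.1.+1%:R^-1)%R.
  by apply: large_folner_set => //; rewrite invr_gt0.
have [g hg] := choice h.
pose Z := fix Z k := if k is k'.+1 then Z k' `|` F (g (k', ncard (Z k')))
  else set0.
have Zf k : finite_set (Z k).
  by elim: k => [|k IH] //=; rewrite finite_setU; split=> //; exact: (Ff _).1.
pose P k := F (g (k, ncard (Z k))).
apply: (@folner_disjoint_mean _ _ S _ act P Z) => //.
- by move=> k; exact: Ff.
- move=> j k; elim: k => // k IH; rewrite ltnS leq_eqVlt => /predU1P[->|/IH PZ].
    by move=> x Px; right.
  by move=> x /PZ Zx; left.
- by move=> k; have [] := hg (k, ncard (Z k)).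
- by move=> k; have [] := hg (k, ncard (Z k)).
(* The bound [K] is uniform in the index, so it survives any reindexing. *)
- move=> e e0; have [K [K0 [Y hY]]] := hyp e e0.
  by exists K; split=> //; exists (fun k => Y (g (k, ncard (Z k)))) => k; exact: hY.
Qed.

Theorem theoremA (R : realType) (G : groupType) (S : seq G)
  (X : pointedType) (act : G -> X -> X) :
  symmetric_gen_set S ->
  is_action act ->
  countable [set: X] -> infinite_set [set: X] ->
  ((exists nu : probability (betaXm X) R,
      [/\ regular_measure nu, ext_invariant act nu & hyperfinite_wrt S act nu])
   <->
   (exists F : nat -> set X, folner_seq R S act F /\ hyperfinite_seq R S act F))
  /\
  ((exists F : nat -> set X, folner_seq R S act F /\ hyperfinite_seq R S act F)
   <->
   (exists mu : set X -> R,
      [/\ is_mean mu, invariant_mean act mu &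
        forall eps : R, (0 < eps)%R ->
          exists Y : set X, (mu Y < eps)%R /\
            exists K : nat, (0 < K)%N /\ components_le S act (~` Y) K])).
Proof.
move=> Ssym actA _ _; split.
  split=> [[nu [nuR nuI nuH]]|[F [Fol hyp]]].
    have [mu [muM muI mu3]] := measure_hyperfinite_mean actA nuR nuI nuH.
    exact: mean_folner muM muI mu3.
  have [mu [muM muI mu3]] := folner_mean Ssym actA Fol hyp.
  exact: mean_hyperfinite_measure muM muI mu3.
split=> [[F [Fol hyp]]|[mu [muM muI mu3]]]; first exact: folner_mean Fol hyp.
exact: mean_folner muM muI mu3.
Qed.
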